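(* Let $M(E,I)$ be a trace monoid and let $L\subseteq M(E,I)$ be a prefix closed trace language. Then for all $n\ge 0$ $$H_n(K_*(L),\Delta\mathbb{Z})\cong H_n(P(E,I),\mathbb{Z}[L])\oplus\mathbb{Z}^{(p_n)}.$$
   Context: $\mathrm{Ab}$ is the category of Abelian groups. An independence relation on a set $E$ (possibly infinite) is an irreflexive symmetric relation $I\subseteq E\times E$. The trace monoid $M(E,I)$ is the quotient of the free monoid $E^*$ by the least equivalence relation with $uabv\equiv ubav$ for all $(a,b)\in I$ and $u,v\in E^*$. Its elements are called traces; a trace language is any set of traces. For $v,w\in M(E,I)$ put $v\le w$ if there is $u\in M(E,I)$ with $vu=w$. This is a partial order; the resulting poset, regarded also as a small category, is denoted $P(E,I)$. A set $L\subseteq M(E,I)$ is prefix closed if for all $v\in M(E,I)$ and $w\in L$, $v<w$ implies $v\in L$. For prefix closed $L$, $M(E,I)$ acts partially on the right on $L$ by $v\cdot\mu=v\mu$ if $v\mu\in L$, and $v\cdot\mu$ undefined otherwise. Put $L_*=L\sqcup\{*\}$ and extend this to a total right action by setting $v\cdot\mu=*$ whenever undefined, and $*\cdot\mu=*$. The category $K_*(L)$ has object set $L_*$; morphisms $s\to s'$ are triples $(s,\mu,s')$ with $\mu\in M(E,I)$ and $s\cdot\mu=s'$; the composite of $(s,\mu,s')$ followed by $(s',\nu,s'')$ is $(s,\mu\nu,s'')$. $\Delta\mathbb{Z}:K_*(L)\to\mathrm{Ab}$ is the constant functor with value $\mathbb{Z}$ on objects and $1_{\mathbb{Z}}$ on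 morphisms. The functor $\mathbb{Z}[L]:P(E,I)\to\mathrm{Ab}$ has $\mathbb{Z}[L](v)=\mathbb{Z}$ for $v\in L$ and $\mathbb{Z}[L](v)=0$ otherwise; for $u\le v$ with $v\in L$ the map $\mathbb{Z}[L](u\le v)$ is $1_{\mathbb{Z}}$, and it is zero if $v\notin L$. For a small category $\mathscr{C}$ and a functor $F:\mathscr{C}\to\mathrm{Ab}$, $H_n(\mathscr{C},F)$ is the $n$-th left derived functor of the colimit functor $\varinjlim^{\mathscr{C}}:\mathrm{Ab}^{\mathscr{C}}\to\mathrm{Ab}$ evaluated at $F$. $p_n$ is the cardinality of the set of $n$-cliques ($n$-element subsets of $E$ whose distinct elements are pairwise related by $I$) of the graph $(E,I)$; in particular $p_0=1$ and $p_1=|E|$. $\mathbb{Z}^{(p)}$ is the direct sum of $p$ copies of $\mathbb{Z}$. *)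

(* Defs.v *)
From HB Require Import structures.
From mathcomp Require Import all_boot all_order all_algebra finmap.
From mathcomp Require Import boolp classical_sets.
From mathcomp Require Import freeg.
From Stdlib Require Import Relation_Definitions Relation_Operators.

Set Implicit Arguments.
Unset Strict Implicit.
Unset Printing Implicit Defensive.

Import GRing.Theory.

Local Open Scope ring_scope.
Local Open Scope quotient_scope.

Definition zmod_isomorphic (A B : zmodType) : Prop :=
  exists f : {additive A -> B}, bijective f.

Section UnitZmodule.

Let unit_add (_ _ : unit) := tt.
Let unit_opp (_ : unit) := tt.

Fact unit_addA : associative unit_add. Proof. by []. Qed.
Fact unit_addC : commutative unit_add. Proof. by []. Qed.
Fact unit_add0 : left_id tt unit_add. Proof. by case. Qed.
Fact unit_addN : left_inverse tt unit_opp unit_add. Proof. by []. Qed.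

HB.instance Definition _ :=
  GRing.isZmodule.Build unit unit_addA unit_addC unit_add0 unit_addN.

End UnitZmodule.

(* [free_ab T] is the direct sum of copies of the integers indexed by [T]. *)
Definition free_ab (T : Type) : zmodType := {freeg {classic T}}.

Definition free_gen (T : Type) (t : T) : free_ab T := << (t : {classic T}) >>.

Section FreeLift.

Variables (T : Type) (A : zmodType) (g : T -> A).

Definition free_lift (x : free_ab T) : A :=
  fglift (g : {classic T} -> zmodule A) x.

Fact free_lift_is_zmod_morphism : zmod_morphism free_lift.
Proof.
by move=> x y; exact: (@lift_is_additive int {classic T} (zmodule A) g x y).
Qed.

HB.instance Definition _ :=
  GRing.isZmodMorphism.Build (free_ab T) A free_lift free_lift_is_zmod_morphism.

Lemma free_lift_gen t : free_lift (free_gen t) = g t.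
Proof.
rewrite /free_lift /free_gen.
by rewrite (@liftU int (zmodule A) {classic T} g 1 t) scale1r.
Qed.

End FreeLift.

Lemma free_ext (T : Type) (A : zmodType) (f g : {additive free_ab T -> A}) :
  (forall t, f (free_gen t) = g (free_gen t)) -> f =1 g.
Proof.
move=> fg x; rewrite -[x]freeg_sumE !raddf_sum; apply: eq_bigr => z _.
by rewrite -[coeff z x]intz -freegU_mulz !raddfMz -/(free_gen z) fg.
Qed.

Section QuotientLift.

Variables (V A : zmodType) (S : zmodClosed V) (f : {additive V -> A}).
Hypothesis fS : forall x, x \in S -> f x = 0.

Definition quot_lift of (forall x, x \in S -> f x = 0) :=
  fun q : {ideal_quot S} => f (repr q).

Lemma quot_lift_pi x : quot_lift fS (\pi x) = f x.
Proof.
apply/eqP; rewrite -subr_eq0 -raddfB /=; apply/eqP/fS.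
by rewrite Quotient.idealrBE reprK.
Qed.

Fact quot_lift_is_zmod_morphism : zmod_morphism (quot_lift fS).
Proof.
move=> x y; rewrite -[x]reprK -[y]reprK -raddfB !quot_lift_pi.
exact: raddfB.
Qed.

HB.instance Definition _ :=
  GRing.isZmodMorphism.Build {ideal_quot S} A (quot_lift fS)
    quot_lift_is_zmod_morphism.

End QuotientLift.

Section Kernel.

Variables (A B : zmodType) (f : {additive A -> B}).

Definition kerp : {pred A} := fun x => f x == 0.

Fact kerp_zmod_closed : zmod_closed kerp.
Proof.
split=> [|x y]; rewrite !unfold_in ?raddf0 //.
by move=> /eqP fx /eqP fy; rewrite raddfB fx fy subr0.
Qed.

HB.instance Definition _ := GRing.isZmodClosed.Build A kerp kerp_zmod_closed.

Definition kernel := {x : A | x \in kerp}.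

HB.instance Definition _ := SubChoice.on kernel.
HB.instance Definition _ := [SubChoice_isSubZmodule of kernel by <:].

Lemma kernelP (x : kernel) : f (val x) = 0.
Proof. by case: x => x /= /eqP. Qed.

Definition kernel_of (x : A) (fx : f x = 0) : kernel :=
  exist (fun x => x \in kerp) x (introT eqP fx).

End Kernel.

(* The homology ker g / im f of A --f--> B --g--> C. *)
Section Homology.

Variables (A B C : zmodType) (f : {additive A -> B}) (g : {additive B -> C}).

Definition boundary : {pred kernel g} := fun z => `[< exists a, f a = val z >].

Fact boundary_zmod_closed : zmod_closed boundary.
Proof.
split=> [|x y]; rewrite !unfold_in.
  by apply/asboolP; exists 0; rewrite !raddf0.
move=> /asboolP[a fa] /asboolP[b fb]; apply/asboolP.
by exists (a - b); rewrite !raddfB fa fb.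
Qed.

HB.instance Definition _ :=
  GRing.isZmodClosed.Build (kernel g) boundary boundary_zmod_closed.

Definition homology : zmodType := {ideal_quot boundary}.

End Homology.

(* [comp f g] is [f] followed by [g]. *)
Record category := Category {
  ob :> Type;
  hom : ob -> ob -> Type;
  idm : forall x, hom x x;
  comp : forall x y z, hom x y -> hom y z -> hom x z;
  comp1m : forall x y (f : hom x y), comp (idm x) f = f;
  compm1 : forall x y (f : hom x y), comp f (idm y) = f;
  compA : forall x y z t (f : hom x y) (g : hom y z) (h : hom z t),
    comp f (comp g h) = comp (comp f g) h }.

Arguments hom {c} x y.
Arguments idm {c} x.
Arguments comp {c x y z} f g.

Record functor_ab (C : category) := FunctorAb {
  fobj :> C -> zmodType;
  fmap : forall x y : C, hom x y -> {additive fobj x -> fobj y};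
  fmap1 : forall x (a : fobj x), fmap (idm x) a = a;
  fmapM : forall x y z (f : hom x y) (g : hom y z) (a : fobj x),
    fmap (comp f g) a = fmap g (fmap f a) }.

Arguments fmap {C} F {x y} f : rename.

Record nat_trans (C : category) (F G : functor_ab C) := NatTrans {
  ntmap :> forall x : C, {additive F x -> G x};
  natural : forall x y (f : hom x y) (a : F x),
    ntmap y (fmap F f a) = fmap G f (ntmap x a) }.

(* Epimorphisms of Ab^C are the pointwise surjective transformations. *)
Definition nt_epi (C : category) (F G : functor_ab C) (e : nat_trans F G) :=
  forall x (b : G x), exists a, e x a = b.

Definition projective (C : category) (P : functor_ab C) : Prop :=
  forall (F G : functor_ab C) (e : nat_trans F G) (f : nat_trans P G),
    nt_epi e -> exists g : nat_trans P F, forall x a, e x (g x a) = f x a.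

(* The colimit of F is the abelian group generated by the pairs (c, x) with
   x in F c, subject to (c, x - y) = (c, x) - (c, y) and (d, F f x) = (c, x)
   for f : c -> d. *)
Section Colimit.

Variables (C : category) (F : functor_ab C).

Let gen (c : C) (x : F c) : free_ab {c : C & F c} := free_gen (existT _ c x).

Inductive colim_null : free_ab {c : C & F c} -> Prop :=
| ColimAdd c (x y : F c) : colim_null (gen (x - y) - (gen x - gen y))
| ColimMap c d (f : hom c d) (x : F c) : colim_null (gen (fmap F f x) - gen x)
| ColimZero : colim_null 0
| ColimSub x y : colim_null x -> colim_null y -> colim_null (x - y).

Definition colim_rel : {pred free_ab {c : C & F c}} :=
  fun x => `[< colim_null x >].

Fact colim_rel_zmod_closed : zmod_closed colim_rel.
Proof.
split=> [|x y]; rewrite !unfold_in; first exact/asboolP/ColimZero.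
by move=> /asboolP x0 /asboolP y0; apply/asboolP/ColimSub.
Qed.

HB.instance Definition _ :=
  GRing.isZmodClosed.Build _ colim_rel colim_rel_zmod_closed.

Definition colim : zmodType := {ideal_quot colim_rel}.

Definition colim_in (c : C) (x : F c) : colim := \pi_{ideal_quot colim_rel} (gen x).

Fact colim_in_is_zmod_morphism c : zmod_morphism (@colim_in c).
Proof.
move=> x y; rewrite /colim_in -!raddfB /=; apply/eqP.
by rewrite -Quotient.idealrBE; apply/asboolP/ColimAdd.
Qed.

HB.instance Definition _ c :=
  GRing.isZmodMorphism.Build (F c) colim (@colim_in c)
    (@colim_in_is_zmod_morphism c).

Lemma colim_in_map c d (f : hom c d) (x : F c) :
  colim_in (fmap F f x) = colim_in x.
Proof.
by apply/eqP; rewrite -Quotient.idealrBE; apply/asboolP/ColimMap.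
Qed.

Section Lift.

Variables (A : zmodType) (g : forall c, {additive F c -> A}).
Hypothesis gF : forall c d (f : hom c d) x, g d (fmap F f x) = g c x.

Let lift : {additive free_ab {c : C & F c} -> A} :=
  @free_lift _ A (fun p : {c : C & F c} => g (projT1 p) (projT2 p)).

Fact colim_lift0 x : x \in colim_rel -> lift x = 0.
Proof.
move=> /asboolP; elim=> {x} [c x y|c d f x||x y _ x0 _ y0].
- by rewrite !raddfB /= !free_lift_gen /= raddfB -opprD subrr.
- by rewrite raddfB /= !free_lift_gen /= gF subrr.
- exact: raddf0.
- by rewrite raddfB x0 y0 subr0.
Qed.

Definition colim_lift : {additive colim -> A} := quot_lift colim_lift0.

Lemma colim_lift_in c (x : F c) : colim_lift (colim_in x) = g c x.
Proof.
by apply: etrans (quot_lift_pi colim_lift0 _) _; rewrite /= free_lift_gen.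
Qed.

Lemma colim_lift_unique (h : {additive colim -> A}) :
  (forall c x, h (@colim_in c x) = g c x) -> h =1 colim_lift.
Proof.
move=> hg q; rewrite -[q]reprK.
apply: etrans (esym (quot_lift_pi colim_lift0 _)).
pose k : {additive free_ab {c : C & F c} -> A} := h \o \pi_{ideal_quot colim_rel}.
apply: (@free_ext _ _ k) => -[c x] /=.
by rewrite free_lift_gen /= -hg.
Qed.

End Lift.

End Colimit.

Section ColimitMap.

Variables (C : category) (F G : functor_ab C) (h : nat_trans F G).

Fact colim_map_cocone c d (f : hom c d) (x : F c) :
  colim_in (h d (fmap F f x)) = colim_in (h c x).
Proof. by rewrite natural colim_in_map. Qed.

Definition colim_map : {additive colim F -> colim G} :=
  colim_lift (g := fun c => @colim_in C G c \o h c) colim_map_cocone.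

End ColimitMap.

Record proj_resolution (C : category) (F : functor_ab C) := ProjResolution {
  res :> nat -> functor_ab C;
  res_proj : forall n, projective (res n);
  res_d : forall n, nat_trans (res n.+1) (res n);
  res_aug : nat_trans (res 0) F;
  res_aug_epi : nt_epi res_aug;
  res_exact0 : forall x a,
    res_aug x a = 0 <-> exists b, res_d 0 x b = a;
  res_exactS : forall n x a,
    res_d n x a = 0 <-> exists b, res_d n.+1 x b = a }.

(* The [n]-th homology group of the complex obtained by applying the colimit
   to the (unaugmented) resolution. *)
Definition colim_homology (C : category) (F : functor_ab C)
    (P : proj_resolution F) (n : nat) : zmodType :=
  match n with
  | 0 => homology (colim_map (res_d P 0)) (\0 : colim (P 0) -> unit)
  | m.+1 => homology (colim_map (res_d P m.+1)) (colim_map (res_d P m))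
  end.

(* Ab^C has enough projectives: F is covered by the direct sum, over c and
   x in F c, of copies of the functors Z[C(c, -)]. *)
Section FreeCover.

Variables (C : category) (F : functor_ab C).

Definition cover_index (d : C) := {c : C & (F c * hom c d)%type}.

Definition cover_push d e (f : hom d e) (i : cover_index d) : cover_index e :=
  existT _ (projT1 i) ((projT2 i).1, comp (projT2 i).2 f).

Definition cover_map d e (f : hom d e) :
    {additive free_ab (cover_index d) -> free_ab (cover_index e)} :=
  free_lift (fun i => free_gen (cover_push f i)).

Fact cover_map1 d a : cover_map (idm d) a = a.
Proof.
apply: (@free_ext _ _ (cover_map (idm d)) idfun) => -[c [x h]] /=.
by rewrite free_lift_gen /cover_push /= compm1.
Qed.

Fact cover_mapM d e t (f : hom d e) (g : hom e t) a :
  cover_map (comp f g) a = cover_map g (cover_map f a).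
Proof.
apply: (@free_ext _ _ _ (cover_map g \o cover_map f)) => -[c [x h]] /=.
by rewrite !free_lift_gen /cover_push /= compA.
Qed.

Definition cover : functor_ab C :=
  @FunctorAb C (fun d => free_ab (cover_index d)) cover_map cover_map1
    cover_mapM.

Definition cover_eval d : {additive cover d -> F d} :=
  free_lift (fun i : cover_index d => fmap F (projT2 i).2 (projT2 i).1).

Fact cover_eval_natural d e (f : hom d e) (a : cover d) :
  cover_eval e (fmap cover f a) = fmap F f (cover_eval d a).
Proof.
apply: (@free_ext _ _ (cover_eval e \o cover_map f)
  (fmap F f \o cover_eval d)) => -[c [x h]] /=.
by rewrite !free_lift_gen /= fmapM.
Qed.

Definition cover_aug : nat_trans cover F := NatTrans cover_eval_natural.

Lemma cover_aug_epi : nt_epi cover_aug.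
Proof.
move=> d x; exists (free_gen (existT _ d (x, idm d) : cover_index d)).
by rewrite /= free_lift_gen /= fmap1.
Qed.

Lemma cover_projective : projective cover.
Proof.
move=> G H e f epi_e.
pose b (c : C) (x : F c) : cover c :=
  free_gen (existT _ c (x, idm c) : cover_index c).
pose lft (p : {c : C & F c}) : G (projT1 p) :=
  projT1 (cid (epi_e _ (f _ (b _ (projT2 p))))).
have lftP c x : e c (lft (existT _ c x)) = f c (b c x).
  by rewrite /lft; case: cid.
pose g d : {additive cover d -> G d} := free_lift (fun i : cover_index d =>
  fmap G (projT2 i).2 (lft (existT _ (projT1 i) (projT2 i).1))).
have g_nat d t (k : hom d t) (a : cover d) :
    g t (fmap cover k a) = fmap G k (g d a).
  apply: (@free_ext _ _ (g t \o cover_map k) (fmap G k \o g d)).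
  by move=> -[c [x h]] /=; rewrite !free_lift_gen /= fmapM.
exists (NatTrans g_nat) => d a /=.
apply: (@free_ext _ _ (e d \o g d) (f d)) => -[c [x h]] /=.
rewrite free_lift_gen /= natural lftP -natural /= free_lift_gen.
by rewrite /cover_push /= comp1m.
Qed.

End FreeCover.

Section KernelFunctor.

Variables (C : category) (F G : functor_ab C) (h : nat_trans F G).

Fact ker_map_subproof x y (f : hom x y) (a : kernel (h x)) :
  h y (fmap F f (val a)) = 0.
Proof. by rewrite natural kernelP raddf0. Qed.

Definition ker_map x y (f : hom x y) (a : kernel (h x)) : kernel (h y) :=
  kernel_of (ker_map_subproof f a).

Fact ker_map_is_zmod_morphism x y (f : hom x y) : zmod_morphism (ker_map f).
Proof. by move=> a b; apply: val_inj; rewrite /= !raddfB. Qed.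

HB.instance Definition _ x y (f : hom x y) :=
  GRing.isZmodMorphism.Build (kernel (h x)) (kernel (h y)) (ker_map f)
    (ker_map_is_zmod_morphism f).

Fact ker_map1 x a : ker_map (idm x) a = a.
Proof. by apply: val_inj; rewrite /= fmap1. Qed.

Fact ker_mapM x y z (f : hom x y) (g : hom y z) a :
  ker_map (comp f g) a = ker_map g (ker_map f a).
Proof. by apply: val_inj; rewrite /= fmapM. Qed.

Definition ker_functor : functor_ab C :=
  @FunctorAb C (fun x => kernel (h x)) (fun x y f => ker_map f) ker_map1
    ker_mapM.

Definition ker_incl : nat_trans ker_functor F :=
  @NatTrans C ker_functor F (fun x => val : kernel (h x) -> F x)
    (fun x y f a => erefl).

End KernelFunctor.

Definition nt_comp (C : category) (F G H : functor_ab C)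
    (h : nat_trans F G) (k : nat_trans G H) : nat_trans F H.
Proof.
exists (fun x => k x \o h x) => x y f a /=.
by rewrite !natural.
Defined.

Section FreeResolution.

Variables (C : category) (F : functor_ab C).

Fixpoint syzygy (n : nat) : functor_ab C :=
  if n is m.+1 then ker_functor (cover_aug (syzygy m)) else F.

Definition free_res (n : nat) : functor_ab C := cover (syzygy n).

Definition free_res_d (n : nat) : nat_trans (free_res n.+1) (free_res n) :=
  nt_comp (cover_aug (syzygy n.+1)) (ker_incl (cover_aug (syzygy n))).

Fact free_res_exact0 x (a : free_res 0 x) :
  cover_aug F x a = 0 <-> exists b, free_res_d 0 x b = a.
Proof.
split=> [a0|[b <-]]; last exact: kernelP.
have [b bE] := @cover_aug_epi C (syzygy 1) x (kernel_of a0).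
by exists b; exact: (congr1 val bE).
Qed.

Fact free_res_exactS n x (a : free_res n.+1 x) :
  free_res_d n x a = 0 <-> exists b, free_res_d n.+1 x b = a.
Proof.
have -> : (free_res_d n x a = 0) <-> (cover_aug (syzygy n.+1) x a = 0).
  split=> [a0|a0]; first exact/val_inj.
  exact: (congr1 val a0).
split=> [a0|[b <-]]; last exact: kernelP.
have [b bE] := @cover_aug_epi C (syzygy n.+2) x (kernel_of a0).
by exists b; exact: (congr1 val bE).
Qed.

Definition free_resolution : proj_resolution F :=
  @ProjResolution C F free_res (fun n => @cover_projective C (syzygy n))
    free_res_d (cover_aug F) (@cover_aug_epi C F) free_res_exact0
    free_res_exactS.

End FreeResolution.

(* H_n(C, F), the n-th left derived functor of the colimit evaluated at F,
   computed with the standard free resolution. *)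
Definition cat_homology (C : category) (F : functor_ab C) (n : nat) :
  zmodType := colim_homology (free_resolution F) n.

Section ConstantFunctor.

Variables (C : category) (A : zmodType).

Definition const_functor : functor_ab C :=
  @FunctorAb C (fun=> A) (fun _ _ _ => idfun) (fun _ _ => erefl)
    (fun _ _ _ _ _ _ => erefl).

End ConstantFunctor.

Section Trace.

Variables (E : choiceType) (I : rel E).

Inductive trace_swap : seq E -> seq E -> Prop :=
| TraceSwap u v a b : I a b ->
    trace_swap (u ++ [:: a, b & v]) (u ++ [:: b, a & v]).

Definition trace_cong : relation (seq E) := clos_refl_sym_trans _ trace_swap.

Definition trace_eq : rel (seq E) := fun v w => `[< trace_cong v w >].

Fact trace_eq_equiv : equiv_class_of trace_eq.
Proof.
split=> [w|v w|v u w].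
- exact/asboolP/rst_refl.
- by apply: asbool_equiv_eq; split; apply: rst_sym.
- by move=> /asboolP vu /asboolP uw; apply/asboolP/(rst_trans _ _ _ _ _ vu).
Qed.

Canonical trace_eq_equivRel := EquivRelPack trace_eq_equiv.
Canonical trace_eq_encModRel := defaultEncModRel trace_eq.

Definition trace := {eq_quot trace_eq}.

HB.instance Definition _ : EqQuotient (seq E) trace_eq trace :=
  EqQuotient.on trace.
HB.instance Definition _ := Choice.on trace.

Definition trace_of (w : seq E) : trace := \pi_trace w.

Lemma trace_ofP v w : trace_of v = trace_of w <-> trace_cong v w.
Proof.
split=> [/eqP|vw]; first by rewrite piE => /asboolP.
by apply/eqP; rewrite piE; apply/asboolP.
Qed.

Lemma trace_cong_catl u v w : trace_cong v w -> trace_cong (u ++ v) (u ++ w).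
Proof.
elim=> [_ _ [s t a b Iab]|s|s t _ st|s t r _ st _ tr].
- by apply: rst_step; rewrite !catA; apply: TraceSwap.
- exact: rst_refl.
- exact: rst_sym.
- exact: rst_trans tr.
Qed.

Lemma trace_cong_catr u v w : trace_cong v w -> trace_cong (v ++ u) (w ++ u).
Proof.
elim=> [_ _ [s t a b Iab]|s|s t _ st|s t r _ st _ tr].
- by apply: rst_step; rewrite -!catA /=; apply: TraceSwap.
- exact: rst_refl.
- exact: rst_sym.
- exact: rst_trans tr.
Qed.

Definition trace_one : trace := trace_of [::].
Definition trace_mul (v w : trace) : trace := trace_of (repr v ++ repr w).

Lemma trace_mulE v w : trace_mul (trace_of v) (trace_of w) = trace_of (v ++ w).
Proof.
have reprP u : trace_cong (repr (trace_of u)) u.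
  by apply/trace_ofP; rewrite /trace_of reprK.
apply/trace_ofP; apply: rst_trans (trace_cong_catl v (reprP w)).
exact/trace_cong_catr/reprP.
Qed.

Lemma trace_of_repr (v : trace) : trace_of (repr v) = v.
Proof. exact: reprK. Qed.

Fact trace_mulA : associative trace_mul.
Proof.
move=> u v w; rewrite -[u]trace_of_repr -[v]trace_of_repr -[w]trace_of_repr.
by rewrite !trace_mulE catA.
Qed.

Fact trace_mul1 : left_id trace_one trace_mul.
Proof. by move=> v; rewrite -[v]trace_of_repr trace_mulE. Qed.

Fact trace_mulr1 : right_id trace_one trace_mul.
Proof. by move=> v; rewrite -[v]trace_of_repr trace_mulE cats0. Qed.

HB.instance Definition _ :=
  isMonoid.Build trace trace_mulA trace_mul1 trace_mulr1.

Definition prefix_le (v w : trace) : Prop := exists u, (v * u)%g = w.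

Definition prefix_lt (v w : trace) : Prop := prefix_le v w /\ v <> w.

Definition prefix_closed (L : set trace) : Prop :=
  forall v w, w \in L -> prefix_lt v w -> v \in L.

Lemma prefix_le_refl v : prefix_le v v.
Proof. by exists 1%g; rewrite mulg1. Qed.

Lemma prefix_le_trans u v w : prefix_le u v -> prefix_le v w -> prefix_le u w.
Proof. by move=> [a <-] [b <-]; exists (a * b)%g; rewrite mulgA. Qed.

(* P(E, I): the homs are propositions, hence have at most one element. *)
Definition prefix_category : category :=
  @Category trace prefix_le prefix_le_refl prefix_le_trans
    (fun _ _ _ => Prop_irrelevance _ _) (fun _ _ _ => Prop_irrelevance _ _)
    (fun _ _ _ _ _ _ _ => Prop_irrelevance _ _).

(* The set of [n]-cliques of the graph (E, I); their number is p_n. *)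
Definition is_clique (n : nat) (A : {fset E}) : bool :=
  (#|` A| == n) &&
  [forall a : A, forall b : A, (val a != val b) ==> I (val a) (val b)].

Definition clique (n : nat) := {A : {fset E} | is_clique n A}.

End Trace.

Section TraceLanguage.

Variables (E : choiceType) (I : rel E) (L : set (trace I)).
Hypothesis L_prefix : prefix_closed L.

Lemma prefix_closed_le v w : w \in L -> prefix_le v w -> v \in L.
Proof.
move=> wL vw; have [->//|/eqP neq] := eqVneq v w.
exact: (L_prefix wL).
Qed.

(* [None] is the extra point * adjoined to L. *)
Definition pointed := option {v : trace I | v \in L}.

Definition act (s : pointed) (mu : trace I) : pointed :=
  obind (fun v : {v : trace I | v \in L} => insub (val v * mu)%g) s.

Lemma act1 s : act s 1%g = s.
Proof. by case: s => [v|] //=; rewrite mulg1 valK. Qed.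

Lemma actM s mu nu : act s (mu * nu)%g = act (act s mu) nu.
Proof.
case: s => [v|] //=; rewrite mulgA.
have [u _ uE|/negP muL] := insubP _ (_ * mu)%g; first by rewrite /= uE.
rewrite insubN //.
apply/negP => munuL; apply/muL/(prefix_closed_le munuL).
by exists nu.
Qed.

Definition act_hom (s t : pointed) := {mu : trace I | act s mu = t}.

Definition act_id (s : pointed) : act_hom s s := exist _ 1%g (act1 s).

Fact act_comp_subproof s t r (f : act_hom s t) (g : act_hom t r) :
  act s (sval f * sval g)%g = r.
Proof. by rewrite actM (svalP f) (svalP g). Qed.

Definition act_comp s t r (f : act_hom s t) (g : act_hom t r) : act_hom s r :=
  exist _ (sval f * sval g)%g (act_comp_subproof f g).

Lemma act_hom_inj s t (f g : act_hom s t) : sval f = sval g -> f = g.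
Proof.
case: f g => [mu muP] [nu nuP] /= e; case: nu / e nuP => nuP.
by congr exist; exact: Prop_irrelevance.
Qed.

Fact act_comp1m s t (f : act_hom s t) : act_comp (act_id s) f = f.
Proof. by apply: act_hom_inj; rewrite /= mul1g. Qed.

Fact act_compm1 s t (f : act_hom s t) : act_comp f (act_id t) = f.
Proof. by apply: act_hom_inj; rewrite /= mulg1. Qed.

Fact act_compA s t r q (f : act_hom s t) (g : act_hom t r) (h : act_hom r q) :
  act_comp f (act_comp g h) = act_comp (act_comp f g) h.
Proof. by apply: act_hom_inj; rewrite /= mulgA. Qed.

(* K_*(L): a morphism s -> t is a trace mu with s . mu = t. *)
Definition state_category : category :=
  Category act_comp1m act_compm1 act_compA.

Definition int_if (b : bool) : zmodType :=
  if b then (int : zmodType) else (unit : zmodType).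

Definition int_if_map (b c : bool) : {additive int_if b -> int_if c} :=
  match b, c return {additive int_if b -> int_if c} with
  | true, true => idfun
  | b, c => \0
  end.

Fact language_map1 v (a : int_if (v \in L)) :
  int_if_map (v \in L) (v \in L) a = a.
Proof. by case: (v \in L) a => // -[]. Qed.

Fact language_mapM u v w (uv : prefix_le u v) (vw : prefix_le v w)
    (a : int_if (u \in L)) :
  int_if_map (u \in L) (w \in L) a =
  int_if_map (v \in L) (w \in L) (int_if_map (u \in L) (v \in L) a).
Proof.
have : w \in L -> v \in L by move=> /prefix_closed_le; apply.
by case: (w \in L) (v \in L) (u \in L) a => [] [] [] //= a /(_ isT).
Qed.

(* Z[L]: the zero group is [unit]; a map is zero unless both ends lie in L. *)
Definition language_functor : functor_ab (prefix_category I) :=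
  @FunctorAb (prefix_category I) (fun v => int_if (v \in L))
    (fun u v _ => int_if_map (u \in L) (v \in L)) language_map1 language_mapM.

End TraceLanguage.

(* Main.v *)
From HB Require Import structures.
Require Import Defs.
From mathcomp Require Import all_boot all_order all_algebra finmap.
From mathcomp Require Import boolp classical_sets.
From mathcomp Require Import wochoice freeg.
From Stdlib Require Import Relation_Operators.

Set Implicit Arguments.
Unset Strict Implicit.
Unset Printing Implicit Defensive.

Import GRing.Theory.

Local Open Scope ring_scope.
Local Open Scope quotient_scope.

(** The category of states and the category of prefixes are both categories of
    elements of a right action of the trace monoid: of the action on the
    pointed set L_* in the first case, and of the action of the monoid on
    itself in the second, because a trace monoid is left cancellative
    ([trace_mulgI]).  For such a category and a set [T] of objects whose
    complement is stable under the action, consider the functor with value Z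
    on [T] and 0 elsewhere.  Its homology is that of a small complex
    ([action_category_homology]): in degree n this complex has a basis of
    cells (s, A) with s in [T] and A = {a_0 < a_1 < ...} an n-clique, and

      d (s, A) = sum_i (-1)^i ((s . a_i, A - a_i) - (s, A - a_i)),

    where a cell outside of [T] counts as zero.  The cliques are oriented by
    means of a well-ordering of the letters.

    Take first [T] to be all of L_*.  The base point is fixed by every letter,
    so the cells over it span a subcomplex with zero differential, which is
    Z^(p_n) in degree n.  The differences between the cell of a trace v in L
    and the cell of the base point with the same clique span a complementary
    subcomplex, and this is a copy of the small complex for [T] = L in the
    category of prefixes.  So the isomorphism holds already between complexes
    ([state_complex_split]).

    The small complex is the colimit of a free resolution.  At an object t the
    resolution has a basis of triples (s, A, mu) with s . A . mu = t, where
    A also stands for the product of its letters, and the differential is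

      d (s, A, mu) = sum_i (-1)^i
        ((s . a_i, A - a_i, mu) - (s, A - a_i, a_i mu)).

    To see that it is exact, fix s and the product x = A mu.  The second half
    of the differential keeps s and x.  The letters that can be moved to the
    front of x, its heads, commute with each other, and the cliques A that
    divide x are exactly the sets of heads; so the second half is the boundary
    map of a full simplex, whose vertices are the heads of x.  Adding the least
    head to A contracts this simplex, unless x = 1.  The first half of the
    differential replaces x by a shorter trace.  Hence a cycle can be pushed,
    modulo boundaries, to smaller and smaller x ([cone_homotopy]), until only
    x = 1 is left, which occurs in degree 0 only and is seen by the
    augmentation.  Finally [resolution_independence] allows this resolution in
    place of the standard one. *)

(** * Isomorphisms and homology of chain complexes *)

(** Bundles a map constructed in the course of a proof. *)
Section AdditiveOf.

Variables (A B : zmodType) (f : A -> B) (f_morph : zmod_morphism f).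

Definition additive_of of zmod_morphism f : A -> B := f.

HB.instance Definition _ :=
  GRing.isZmodMorphism.Build A B (additive_of f_morph) f_morph.

End AdditiveOf.

Lemma zmod_isomorphic_sym (A B : zmodType) :
  zmod_isomorphic A B -> zmod_isomorphic B A.
Proof.
move=> [f [g fK gK]].
have gB : zmod_morphism g.
  by move=> x y; apply: (can_inj fK); rewrite raddfB !gK.
by exists (additive_of gB); exists f.
Qed.

Lemma zmod_isomorphic_trans (A B C : zmodType) :
  zmod_isomorphic A B -> zmod_isomorphic B C -> zmod_isomorphic A C.
Proof.
by move=> [f f_bij] [g g_bij]; exists (g \o f); exact: bij_comp.
Qed.

Lemma bijective_of_surjective (A B : Type) (f : A -> B) :
  injective f -> (forall y, exists x, f x = y) -> bijective f.
Proof.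
move=> f_inj /choice[g gK]; exists g => // x; exact/f_inj/gK.
Qed.

Section ProductIso.

Variables (A B D : zmodType) (f : {additive A -> B}).

Definition prod_map (p : A * D) : B * D := (f p.1, p.2).

Fact prod_map_is_zmod_morphism : zmod_morphism prod_map.
Proof. by move=> x y; rewrite /prod_map /= raddfB. Qed.

HB.instance Definition _ :=
  GRing.isZmodMorphism.Build (A * D)%type (B * D)%type prod_map
    prod_map_is_zmod_morphism.

End ProductIso.

Lemma zmod_isomorphic_prod (A B D : zmodType) :
  zmod_isomorphic A B -> zmod_isomorphic (A * D)%type (B * D)%type.
Proof.
move=> [f [g fK gK]]; exists (@prod_map A B D f).
by exists (fun p => (g p.1, p.2)) => -[a d]; rewrite /= /prod_map /= ?fK ?gK.
Qed.

Lemma quot_eq0 (V : zmodType) (S : zmodClosed V) (x : V) :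
  \pi_{ideal_quot S} x = 0 <-> x \in S.
Proof.
rewrite -[x in x \in S]subr0 Quotient.idealrBE.
rewrite -[0 in X in X <-> _](raddf0 \pi_{ideal_quot S}).
by split=> [->|/eqP].
Qed.

(** The first isomorphism theorem for [homology]. *)
Lemma homology_iso_of_surjection (A B C X : zmodType) (f : {additive A -> B})
    (g : {additive B -> C}) (q : {additive kernel g -> X}) :
    (forall x, exists z, q z = x) ->
    (forall z, q z = 0 <-> exists a, f a = val z) ->
  zmod_isomorphic (homology f g) X.
Proof.
move=> q_surj q_ker.
have q0 z : z \in @boundary _ _ _ f g -> q z = 0 by move=> /asboolP /q_ker.
exists (quot_lift q0); apply: bijective_of_surjective.
  apply: raddf_inj => x; rewrite -[x]reprK.
  move=> /(etrans (esym (quot_lift_pi q0 _)))/q_ker z0.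
  by apply/quot_eq0/asboolP.
by move=> x; have [z <-] := q_surj x; exists (\pi z); exact: quot_lift_pi.
Qed.

Section HomologyClass.

Variables (A B C : zmodType) (f : {additive A -> B}) (g : {additive B -> C}).

Definition hclass (z : kernel g) : homology f g := \pi z.

Fact hclass_is_zmod_morphism : zmod_morphism hclass.
Proof. exact: (raddfB \pi_{ideal_quot (@boundary _ _ _ f g)}). Qed.

HB.instance Definition _ :=
  GRing.isZmodMorphism.Build (kernel g) (homology f g) hclass
    hclass_is_zmod_morphism.

Lemma hclass_surj x : exists z, hclass z = x.
Proof. by exists (repr x); rewrite /hclass reprK. Qed.

Lemma hclass0P z : hclass z = 0 <-> exists a, f a = val z.
Proof.
by split=> [/quot_eq0/asboolP|z0] //; apply/quot_eq0/asboolP.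
Qed.

End HomologyClass.

Arguments hclass {A B C} f g z.

Section KernelMap.

Variables (A B C D : zmodType) (g : {additive A -> B}) (k : {additive C -> D}).
Variables (v : {additive A -> C}).
Hypothesis vP : forall x, g x = 0 -> k (v x) = 0.

Definition kernel_map (z : kernel g) : kernel k := kernel_of (vP (kernelP z)).

Fact kernel_map_is_zmod_morphism : zmod_morphism kernel_map.
Proof. by move=> x y; apply: val_inj; rewrite /= !raddfB. Qed.

HB.instance Definition _ :=
  GRing.isZmodMorphism.Build (kernel g) (kernel k) kernel_map
    kernel_map_is_zmod_morphism.

End KernelMap.

(** The hypotheses hold in each degree of a homotopy equivalence.  They mention
    cycles only, because on cycles one of the two terms [d s] and [s d] of a
    homotopy vanishes. *)
Lemma homology_iso_of_equivalence (A B C A' B' C' : zmodType)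
    (f : {additive A -> B}) (g : {additive B -> C})
    (f' : {additive A' -> B'}) (g' : {additive B' -> C'})
    (v : {additive B -> B'}) (v' : {additive B' -> B}) :
    (forall b, g b = 0 -> g' (v b) = 0) ->
    (forall b, g' b = 0 -> g (v' b) = 0) ->
    (forall a, exists a', v (f a) = f' a') ->
    (forall a, exists a', v' (f' a) = f a') ->
    (forall b, g b = 0 -> exists a, f a = v' (v b) - b) ->
    (forall b, g' b = 0 -> exists a, f' a = v (v' b) - b) ->
  zmod_isomorphic (homology f g) (homology f' g').
Proof.
move=> vg v'g vf v'f hB hB'.
pose q : {additive kernel g -> homology f' g'} := hclass f' g' \o kernel_map vg.
apply: (@homology_iso_of_surjection _ _ _ _ f g q) => [x|z].
  have [z <-] := hclass_surj x; exists (kernel_map v'g z).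
  apply/eqP; rewrite -subr_eq0 /q /= -raddfB; apply/eqP/hclass0P.
  by have [a aE] := hB' _ (kernelP z); exists a.
have -> : (q z = 0) <-> exists a, f' a = v (val z) by exact: hclass0P.
split=> [[a aE]|[a <-]]; last by have [a' ->] := vf a; exists a'.
have [b bE] := hB _ (kernelP z); have [c cE] := v'f a.
exists (c - b); rewrite raddfB bE -cE aE opprB addrC.
by rewrite addrNK.
Qed.

(** The case distinction is that of [colim_homology], which is thereby
    convertible to the chain homology of a sequence of colimits. *)
Definition chain_homology (X : nat -> zmodType)
    (d : forall n, {additive X n.+1 -> X n}) (n : nat) : zmodType :=
  match n with
  | 0 => homology (d 0) (\0 : X 0 -> unit)
  | m.+1 => homology (d m.+1) (d m)
  end.

Lemma chain_homology_iso_of_iso (X Y : nat -> zmodType)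
    (dX : forall n, {additive X n.+1 -> X n})
    (dY : forall n, {additive Y n.+1 -> Y n})
    (v : forall n, {additive X n -> Y n})
    (w : forall n, {additive Y n -> X n}) :
    (forall n, cancel (v n) (w n)) -> (forall n, cancel (w n) (v n)) ->
    (forall n x, v n (dX n x) = dY n (v n.+1 x)) ->
  forall n, zmod_isomorphic (chain_homology dX n) (chain_homology dY n).
Proof.
move=> vK wK vd.
have wd n y : w n (dY n y) = dX n (w n.+1 y).
  by apply: (can_inj (vK n)); rewrite wK vd wK.
case=> [|n]; apply: (homology_iso_of_equivalence (v := v _) (v' := w _)) => //=.
- by move=> a; exists (v _ a); exact: vd.
- by move=> a; exists (w _ a); exact: wd.
- by move=> a _; exists 0; rewrite vK subrr raddf0.
- by move=> a _; exists 0; rewrite wK subrr raddf0.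
- by move=> b b0; rewrite -vd b0 raddf0.
- by move=> b b0; rewrite -wd b0 raddf0.
- by move=> a; exists (v _ a); exact: vd.
- by move=> a; exists (w _ a); exact: wd.
- by move=> a _; exists 0; rewrite vK subrr raddf0.
- by move=> a _; exists 0; rewrite wK subrr raddf0.
Qed.

(** The maps exhibit [X] as the direct sum of the complexes [Y] and [Z], where
    [Z] has zero differential and so is its own homology. *)
Lemma chain_homology_split (X Y Z : nat -> zmodType)
    (dX : forall n, {additive X n.+1 -> X n})
    (dY : forall n, {additive Y n.+1 -> Y n})
    (p : forall n, {additive X n -> Y n}) (i : forall n, {additive Y n -> X n})
    (r : forall n, {additive X n -> Z n})
    (k : forall n, {additive Z n -> X n}) :
    (forall n y, p n (i n y) = y) -> (forall n z, r n (k n z) = z) ->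
    (forall n z, p n (k n z) = 0) -> (forall n y, r n (i n y) = 0) ->
    (forall n x, i n (p n x) + k n (r n x) = x) ->
    (forall n x, p n (dX n x) = dY n (p n.+1 x)) ->
    (forall n y, i n (dY n y) = dX n (i n.+1 y)) ->
    (forall n x, r n (dX n x) = 0) -> (forall n z, dX n (k n.+1 z) = 0) ->
  forall n, zmod_isomorphic (chain_homology dX n)
    (chain_homology dY n * Z n)%type.
Proof.
move=> pi rk pk ri ipkr pd id' rd dk.
have main n (C C' : zmodType) (g : {additive X n -> C})
    (g' : {additive Y n -> C'}) :
    (forall x, g x = 0 -> g' (p n x) = 0) ->
    (forall y, g' y = 0 -> g (i n y) = 0) -> (forall z, g (k n z) = 0) ->
  zmod_isomorphic (homology (dX n) g) (homology (dY n) g' * Z n)%type.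
  move=> pg ig kg.
  pose q (z : kernel g) : homology (dY n) g' * Z n :=
    (hclass (dY n) g' (kernel_map pg z), r n (val z)).
  have qB : zmod_morphism q by move=> x y; rewrite /q !raddfB.
  apply: (@homology_iso_of_surjection _ _ _ _ (dX n) g (additive_of qB)).
    move=> [x z] /=; have [y <-] := hclass_surj x.
    have yz0 : g (i n (val y) + k n z) = 0 :> C.
      by rewrite raddfD kg ig ?addr0 ?kernelP.
    exists (kernel_of yz0).
    rewrite /= /additive_of /q /= raddfD rk ri add0r; congr (_, _).
    by congr hclass; apply: val_inj; rewrite /= raddfD pi pk addr0.
  move=> z; rewrite /= /additive_of /q /=.
  split=> [[/hclass0P[y yE] rz]|[a aE]].
    exists (i n.+1 y); rewrite -id' yE /=.
    by rewrite -[RHS](ipkr n) rz raddf0 addr0.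
  rewrite -aE rd; congr (_, _); apply/hclass0P.
  by exists (p n.+1 a); rewrite /= -aE pd.
case=> [|n] /=; apply: main => // x.
  by rewrite -pd => ->; rewrite raddf0.
by rewrite -id' => ->; rewrite raddf0.
Qed.

(** * Independence of the projective resolution *)

Section NatTransOperations.

Variables (C : category) (F G : functor_ab C).

Definition nt_id : nat_trans F F :=
  @NatTrans C F F (fun x => idfun) (fun x y f a => erefl).

Definition nt_zero : nat_trans F G.
Proof. by exists (fun x => \0) => x y f a /=; rewrite raddf0. Defined.

Definition nt_sub (h k : nat_trans F G) : nat_trans F G.
Proof.
exists (fun x => h x \- k x) => x y f a /=.
by rewrite !natural raddfB.
Defined.

End NatTransOperations.

(** By exactness [d1] is an epimorphism onto the kernel of [d0], and [f] factors
    through this kernel. *)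
Lemma projective_lift (C : category) (P G2 G1 G0 : functor_ab C)
    (d1 : nat_trans G2 G1) (d0 : nat_trans G1 G0) (f : nat_trans P G1) :
    projective P ->
    (forall x a, d0 x a = 0 -> exists b, d1 x b = a) ->
    (forall x a, d0 x (d1 x a) = 0) ->
    (forall x a, d0 x (f x a) = 0) ->
  exists g : nat_trans P G2, forall x a, d1 x (g x a) = f x a.
Proof.
move=> P_proj d_exact dd0 df0.
have corestr (H : functor_ab C) (h : nat_trans H G1) :
    (forall x a, d0 x (h x a) = 0) ->
  exists k : nat_trans H (ker_functor d0), forall x a, val (k x a) = h x a.
  move=> dh0.
  have k_morph x : zmod_morphism (fun a => kernel_of (dh0 x a)).
    by move=> a b; apply: val_inj; rewrite /= !raddfB.
  have k_nat x y (e : Defs.hom x y) a :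
      additive_of (k_morph y) (fmap H e a) =
      fmap (ker_functor d0) e (additive_of (k_morph x) a).
    by apply: val_inj; rewrite /= natural.
  by exists (@NatTrans C H (ker_functor d0) (fun x => additive_of (k_morph x))
    k_nat).
have [e eE] := corestr _ _ dd0; have [k kE] := corestr _ _ df0.
have e_epi : nt_epi e.
  move=> x b; have [a aE] := d_exact _ _ (kernelP b).
  by exists a; apply: val_inj; rewrite eE.
have [g gE] := P_proj _ _ e k e_epi.
by exists g => x a; rewrite -eE gE kE.
Qed.

(** It is the relation between the last two terms that permits the choice of the
    next one, so the recursion goes over pairs of consecutive terms. *)
Lemma dependent_choice (X : nat -> Type) (R : forall n, X n -> X n.+1 -> Prop)
    (x0 : X 0) (x1 : X 1) :
    R 0 x0 x1 -> (forall n x y, R n x y -> exists z, R n.+1 y z) ->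
  exists s : forall n, X n, s 0 = x0 /\ forall n, R n (s n) (s n.+1).
Proof.
move=> R0 step.
pose Y n := {p : X n * X n.+1 | R n p.1 p.2}.
pose next n (p : Y n) : Y n.+1 :=
  exist (fun q => R n.+1 q.1 q.2)
    ((sval p).2, projT1 (cid (step n _ _ (svalP p))))
    (projT2 (cid (step n _ _ (svalP p)))).
pose Y0 : Y 0 := exist (fun q => R 0 q.1 q.2) (x0, x1) R0.
pose s := nat_rect Y Y0 next.
exists (fun n => (sval (s n)).1); split=> // n.
exact: (svalP (s n)).
Qed.

(** With the resolved functor in degree 0 the complex is exact everywhere, so
    that the induction steps below need no special case for the augmentation. *)
Section AugmentedComplex.

Variables (C : category) (F : functor_ab C) (P : proj_resolution F).

Definition aug_ob (n : nat) : functor_ab C := if n is m.+1 then P m else F.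

Definition aug_d (n : nat) : nat_trans (aug_ob n.+1) (aug_ob n) :=
  match n with 0 => res_aug P | m.+1 => res_d P m end.

Lemma aug_exact n x a : aug_d n x a = 0 -> exists b, aug_d n.+1 x b = a.
Proof.
case: n a => [|n] a; first by case: (@res_exact0 _ _ P x a).
by case: (@res_exactS _ _ P n x a).
Qed.

Lemma aug_dd n x a : aug_d n x (aug_d n.+1 x a) = 0.
Proof.
case: n a => [|n] a; first by apply/(@res_exact0 _ _ P); exists a.
by apply/(@res_exactS _ _ P); exists a.
Qed.

End AugmentedComplex.

#[local] Opaque colim_map.

Lemma colim_map_in (C : category) (G H : functor_ab C) (h : nat_trans G H) c
    (x : G c) :
  colim_map h (colim_in x) = colim_in (h c x).
Proof. exact: colim_lift_in. Qed.

Lemma colim_ext (C : category) (G : functor_ab C) (A : zmodType)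
    (f g : {additive colim G -> A}) :
  (forall c (x : G c), f (colim_in x) = g (colim_in x)) -> f =1 g.
Proof.
move=> fg.
pose k c : {additive G c -> A} := g \o @colim_in C G c.
have kG c d (e : Defs.hom c d) x : k d (fmap G e x) = k c x.
  by rewrite /k /= colim_in_map.
move=> x; rewrite (@colim_lift_unique C G A k kG f) //.
by rewrite -(@colim_lift_unique C G A k kG g).
Qed.

Section Comparison.

Variables (C : category) (F : functor_ab C) (P Q : proj_resolution F).

Lemma comparison_map : exists f : forall n, nat_trans (aug_ob P n) (aug_ob Q n),
  f 0 = nt_id F /\
  forall n x a, aug_d Q n x (f n.+1 x a) = f n x (aug_d P n x a).
Proof.
have [f1 f1E] := @res_proj _ _ P 0 _ _ _ (res_aug P) (@res_aug_epi _ _ Q).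
apply: (@dependent_choice (fun n => nat_trans (aug_ob P n) (aug_ob Q n))
  (fun n g h => forall x a, aug_d Q n x (h x a) = g x (aug_d P n x a))
  (nt_id F) f1) => // n g h ghE.
have [|||k kE] := @projective_lift _ _ _ _ _ (aug_d Q n.+1) (aug_d Q n)
  (nt_comp (aug_d P n.+1) h) (@res_proj _ _ P n.+1); last by exists k.
- exact: aug_exact.
- exact: aug_dd.
- by move=> x a /=; rewrite ghE aug_dd raddf0.
Qed.

(** [s n.+1] is a lift of [f n.+1 - s n d], which takes values in the cycles by
    the equation for [s n]. *)
Lemma comparison_homotopy (f : forall n, nat_trans (aug_ob P n) (aug_ob Q n)) :
    (forall x a, f 0 x a = 0) ->
    (forall n x a, aug_d Q n x (f n.+1 x a) = f n x (aug_d P n x a)) ->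
  exists s : forall n, nat_trans (aug_ob P n) (aug_ob Q n.+1),
    (forall x a, s 0 x a = 0) /\
    forall n x a,
      f n.+1 x a = aug_d Q n.+1 x (s n.+1 x a) + s n x (aug_d P n x a).
Proof.
move=> f0 fd.
pose R n (s : nat_trans (aug_ob P n) (aug_ob Q n.+1))
    (s' : nat_trans (aug_ob P n.+1) (aug_ob Q n.+2)) :=
  forall x a, f n.+1 x a = aug_d Q n.+1 x (s' x a) + s x (aug_d P n x a).
have step n (s : nat_trans (aug_ob P n) (aug_ob Q n.+1)) :
    (forall x a, aug_d Q n x (s x (aug_d P n x a)) = f n x (aug_d P n x a)) ->
  exists s', R n s s'.
  move=> sE.
  have [//|||s' s'E] := @projective_lift _ _ _ _ _ (aug_d Q n.+1) (aug_d Q n)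
    (nt_sub (f n.+1) (nt_comp (aug_d P n) s)) (@res_proj _ _ P n).
  - exact: aug_exact.
  - exact: aug_dd.
  - by move=> x a /=; rewrite raddfB /= fd sE subrr.
  by exists s' => x a; rewrite s'E /= subrK.
have [s1 s1E] : exists s1, R 0 (nt_zero _ _) s1.
  by apply: step => x a /=; rewrite raddf0 f0.
have [|s [s0 sE]] := @dependent_choice
    (fun n => nat_trans (aug_ob P n) (aug_ob Q n.+1)) R _ s1 s1E; last first.
  by exists s; split=> // x a; rewrite s0.
move=> n s s' ss'; apply: step => x a.
by rewrite (ss' x) aug_dd raddf0 addr0.
Qed.

End Comparison.

(** Comparison maps in both directions are mutually inverse up to homotopy; the
    colimit preserves chain maps and homotopies. *)
Theorem resolution_independence (C : category) (F : functor_ab C)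
    (P Q : proj_resolution F) n :
  zmod_isomorphic (colim_homology P n) (colim_homology Q n).
Proof.
have [f [f0 fd]] := comparison_map P Q.
have [g [g0 gd]] := comparison_map Q P.
have homotopic (R S : proj_resolution F)
    (h : forall n, nat_trans (aug_ob R n) (aug_ob S n))
    (k : forall n, nat_trans (aug_ob S n) (aug_ob R n)) :
    h 0 = nt_id F -> k 0 = nt_id F ->
    (forall n x a, aug_d S n x (h n.+1 x a) = h n x (aug_d R n x a)) ->
    (forall n x a, aug_d R n x (k n.+1 x a) = k n x (aug_d S n x a)) ->
  exists s : forall n, nat_trans (aug_ob R n) (aug_ob R n.+1),
    (forall x a, s 0 x a = 0) /\
    forall n x a, k n.+1 x (h n.+1 x a) - a =
      aug_d R n.+1 x (s n.+1 x a) + s n x (aug_d R n x a).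
  move=> h0 k0 hd kd.
  have [||s [s0 sE]] := @comparison_homotopy _ _ R R
    (fun n => nt_sub (nt_comp (h n) (k n)) (nt_id _)).
  - by move=> x a; rewrite /= h0 k0 /= subrr.
  - by move=> m x a /=; rewrite raddfB /= kd hd.
  by exists s; split=> // m x a; rewrite -sE.
have cycles (R S : proj_resolution F)
    (h : forall n, nat_trans (aug_ob R n) (aug_ob S n)) :
    (forall n x a, aug_d S n x (h n.+1 x a) = h n x (aug_d R n x a)) ->
  forall m a, colim_map (res_d S m) (colim_map (h m.+2) a) =
    colim_map (h m.+1) (colim_map (res_d R m) a).
  move=> hd m; apply: (@colim_ext _ _ _
    (colim_map (res_d S m) \o colim_map (h m.+2))
    (colim_map (h m.+1) \o colim_map (res_d R m))) => c x /=.
  by rewrite !colim_map_in (hd m.+1).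
have [s [s0 sE]] := homotopic _ _ _ _ f0 g0 fd gd.
have [t [t0 tE]] := homotopic _ _ _ _ g0 f0 gd fd.
have boundaries (R S : proj_resolution F)
    (h : forall n, nat_trans (aug_ob R n) (aug_ob S n))
    (k : forall n, nat_trans (aug_ob S n) (aug_ob R n))
    (u : forall n, nat_trans (aug_ob R n) (aug_ob R n.+1)) :
    (forall x a, u 0 x a = 0) ->
    (forall n x a, k n.+1 x (h n.+1 x a) - a =
      aug_d R n.+1 x (u n.+1 x a) + u n x (aug_d R n x a)) ->
  (forall a, exists b, colim_map (res_d R 0) b =
     colim_map (k 1) (colim_map (h 1) a) - a) /\
  forall m a, colim_map (res_d R m) a = 0 -> exists b,
    colim_map (res_d R m.+1) b = colim_map (k m.+2) (colim_map (h m.+2) a) - a.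
  move=> u0 uE; split=> [a|m a da].
    exists (colim_map (u 1) a).
    apply: (@colim_ext _ _ _ (colim_map (res_d R 0) \o colim_map (u 1))
      ((colim_map (k 1) \o colim_map (h 1)) \- idfun)) => c x /=.
    by rewrite !colim_map_in -raddfB uE u0 addr0.
  exists (colim_map (u m.+2) a).
  rewrite -[LHS]addr0 -(raddf0 (colim_map (u m.+1))) -da.
  apply: (@colim_ext _ _ _ ((colim_map (res_d R m.+1) \o colim_map (u m.+2))
      \+ (colim_map (u m.+1) \o colim_map (res_d R m)))
    ((colim_map (k m.+2) \o colim_map (h m.+2)) \- idfun)) => c x /=.
  by rewrite !colim_map_in -raddfB -raddfD uE.
have [PB0 PBS] := boundaries _ _ _ _ _ s0 sE.
have [QB0 QBS] := boundaries _ _ _ _ _ t0 tE.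
case: n => [|n].
  apply: (homology_iso_of_equivalence (v := colim_map (f 1))
    (v' := colim_map (g 1))) => //= a.
  - by exists (colim_map (f 2) a); rewrite -cycles.
  - by exists (colim_map (g 2) a); rewrite -cycles.
apply: (homology_iso_of_equivalence (v := colim_map (f n.+2))
    (v' := colim_map (g n.+2))) => a.
- by move=> a0; rewrite cycles // a0 raddf0.
- by move=> a0; rewrite cycles // a0 raddf0.
- by exists (colim_map (f n.+3) a); rewrite -cycles.
- by exists (colim_map (g n.+3) a); rewrite -cycles.
- exact: PBS.
- exact: QBS.
Qed.

(** * Free functors *)

Lemma free_ab_ind (T : Type) (P : free_ab T -> Prop) :
    P 0 -> (forall x y, P x -> P y -> P (x - y)) ->
    (forall t, P (free_gen t)) ->
  forall x, P x.
Proof.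
move=> P0 PB Pgen.
have PN x : P x -> P (- x) by move=> Px; rewrite -[- x]add0r; exact: PB.
have PD x y : P x -> P y -> P (x + y).
  by move=> Px /PN Py; rewrite -[y]opprK; exact: PB.
have Pz x (m : int) : P x -> P (x *~ m).
  move=> Px; have Pn k : P (x *+ k).
    by elim: k => // k IHk; rewrite mulrS; exact: PD.
  by case: m => k; rewrite ?NegzE ?mulrNz; [exact: Pn|exact/PN/Pn].
move=> x; rewrite -[x]freeg_sumE; elim/big_ind: _ => // z _.
by rewrite -[coeff z x]intz -freegU_mulz; exact/Pz/Pgen.
Qed.

(** The direct sum over [j] of the functors Z[C(X j, -)]. *)
Section FreeFunctor.

Variables (C : category) (J : Type) (X : J -> C).

Definition free_index (t : C) := {j : J & Defs.hom (X j) t}.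

Definition free_index_pair t j (f : Defs.hom (X j) t) : free_index t :=
  existT (fun j => Defs.hom (X j) t) j f.

Definition free_push t t' (e : Defs.hom t t') :
    {additive free_ab (free_index t) -> free_ab (free_index t')} :=
  free_lift (fun i : free_index t =>
    free_gen (free_index_pair (Defs.comp (projT2 i) e))).

Fact free_push1 t a : free_push (idm t) a = a.
Proof.
apply: (@free_ext _ _ (free_push (idm t)) idfun) => -[j f].
by rewrite /= free_lift_gen /= compm1.
Qed.

Fact free_pushM t t' t'' (e : Defs.hom t t') (e' : Defs.hom t' t'') a :
  free_push (Defs.comp e e') a = free_push e' (free_push e a).
Proof.
apply: (@free_ext _ _ _ (free_push e' \o free_push e)) => -[j f] /=.
by rewrite !free_lift_gen /= Defs.compA.
Qed.

Definition free_functor : functor_ab C :=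
  @FunctorAb C (fun t => free_ab (free_index t)) free_push free_push1
    free_pushM.

Definition fgen t j (f : Defs.hom (X j) t) : free_functor t :=
  free_gen (free_index_pair f).

Lemma fgen_push t t' (e : Defs.hom t t') j (f : Defs.hom (X j) t) :
  fmap free_functor e (fgen f) = fgen (Defs.comp f e).
Proof. exact: free_lift_gen. Qed.

Lemma free_functor_ext t (A : zmodType)
    (g h : {additive free_functor t -> A}) :
  (forall j (f : Defs.hom (X j) t), g (fgen f) = h (fgen f)) -> g =1 h.
Proof. by move=> gh; apply: free_ext => -[j f]; exact: gh. Qed.

(** Yoneda: a transformation out of [free_functor] is a family of elements. *)
Section Yoneda.

Variables (G : functor_ab C) (y : forall j, G (X j)).

Definition yoneda_map t : {additive free_functor t -> G t} :=
  free_lift (fun i : free_index t => fmap G (projT2 i) (y (projT1 i))).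

Lemma yoneda_map_gen t j (f : Defs.hom (X j) t) :
  yoneda_map t (fgen f) = fmap G f (y j).
Proof. exact: free_lift_gen. Qed.

Fact yoneda_natural t t' (e : Defs.hom t t') (a : free_functor t) :
  yoneda_map t' (fmap free_functor e a) = fmap G e (yoneda_map t a).
Proof.
apply: (@free_functor_ext _ _ (yoneda_map t' \o fmap free_functor e)
  (fmap G e \o yoneda_map t)) => j f.
apply: etrans (congr1 (yoneda_map t') (fgen_push e f)) _.
rewrite yoneda_map_gen fmapM; congr (fmap G e _).
exact: esym (yoneda_map_gen f).
Qed.

Definition yoneda : nat_trans free_functor G := NatTrans yoneda_natural.

End Yoneda.

(** A lift of a transformation is determined by lifts of the elements that
    correspond to it under the Yoneda lemma. *)
Lemma free_functor_projective : projective free_functor.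
Proof.
move=> G H e f e_epi.
pose y j : G (X j) := projT1 (cid (e_epi _ (f _ (fgen (idm (X j)))))).
have yE j : e (X j) (y j) = f (X j) (fgen (idm (X j))) by rewrite /y; case: cid.
exists (yoneda y) => t a.
apply: (@free_functor_ext _ _ (e t \o yoneda y t) (f t)) => j h.
apply: etrans (congr1 (e t) (yoneda_map_gen y h)) _.
rewrite natural yE -natural; congr (f t _).
by apply: etrans (fgen_push _ _) _; rewrite comp1m.
Qed.

(** The colimit of Z[C(X j, -)] is Z, since every morphism out of [X j] is
    identified with the identity. *)
Definition colim_free : {additive colim free_functor -> free_ab J} :=
  colim_lift (yoneda_natural (G := const_functor C (free_ab J)) (@free_gen J)).

Definition free_colim : {additive free_ab J -> colim free_functor} :=
  free_lift (fun j => colim_in (fgen (idm (X j)))).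

Lemma colim_free_in t j (f : Defs.hom (X j) t) :
  colim_free (colim_in (fgen f)) = free_gen j.
Proof.
apply: etrans (colim_lift_in _ _) _; exact: free_lift_gen.
Qed.

Lemma colim_freeK : cancel colim_free free_colim.
Proof.
apply: (@colim_ext _ _ _ (free_colim \o colim_free) idfun) => t.
apply: (@free_functor_ext _ _ ((free_colim \o colim_free) \o @colim_in _ _ t)
  (@colim_in _ _ t)) => j f.
apply: etrans (congr1 free_colim (colim_free_in f)) _.
apply: etrans (free_lift_gen _ _) _; rewrite -[LHS](colim_in_map f).
by congr (colim_in _); apply: etrans (fgen_push _ _) _; rewrite comp1m.
Qed.

Lemma free_colimK : cancel free_colim colim_free.
Proof.
apply: (@free_ext _ _ (colim_free \o free_colim) idfun) => j.
apply: etrans (congr1 colim_free (free_lift_gen _ _)) _.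
exact: colim_free_in.
Qed.

End FreeFunctor.

(** * Heads of traces *)

Section TraceHeads.

Variables (E : choiceType) (I : rel E).
Hypotheses (I_irr : irreflexive I) (I_sym : symmetric I).

Implicit Types (a b : E) (w : seq E) (x y : trace I).

Lemma trace_cong_invariant (T : Type) (f : seq E -> T) :
  (forall u v a b, I a b -> f (u ++ [:: a, b & v]) = f (u ++ [:: b, a & v])) ->
  forall v w, trace_cong I v w -> f v = f w.
Proof.
by move=> fE v w; elim=> // [_ _ [u t a b /fE]|s t r _ -> _ ->].
Qed.

(** The first [a] in [w] commutes with the letters before it, so that it can be
    moved to the front. *)
Fixpoint head_word a w : bool :=
  if w is b :: w' then (a == b) || I a b && head_word a w' else false.

Lemma head_word_swap c u v a b : I a b ->
  head_word c (u ++ [:: a, b & v]) = head_word c (u ++ [:: b, a & v]).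
Proof.
move=> Iab; elim: u => [|d u /= -> //] /=.
have [->|_] := eqVneq c a; first by rewrite Iab /= orbT.
have [->|_] := eqVneq c b; first by rewrite I_sym Iab.
by rewrite /= andbCA.
Qed.

(** Removing the first [c] is compatible with commutations, even where [c] is
    not a head, because it removes the same letter before and after a swap. *)
Lemma trace_of_rem_swap c u v a b : I a b ->
  trace_of I (rem c (u ++ [:: a, b & v])) =
  trace_of I (rem c (u ++ [:: b, a & v])).
Proof.
move=> Iab; have swap w w' : trace_of I (w ++ [:: a, b & w']) =
    trace_of I (w ++ [:: b, a & w']).
  exact/trace_ofP/rst_step/TraceSwap.
elim: u => [|d u IHu] /=.
  have [ac|ac] := eqVneq a c; have [bc|bc] := eqVneq b c => //.
    by move: Iab; rewrite ac bc I_irr.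
  exact: (swap [::]).
case: eqP => // _; move/trace_ofP: IHu => IHu.
exact/trace_ofP/(trace_cong_catl [:: d]).
Qed.

Lemma trace_ofM w w' : trace_of I (w ++ w') = (trace_of I w * trace_of I w')%g.
Proof. exact: esym (trace_mulE _ _ _). Qed.

Lemma trace_of_nil : trace_of I [::] = 1%g.
Proof. by []. Qed.

Lemma trace_of_cons a w :
  trace_of I (a :: w) = (trace_of I [:: a] * trace_of I w)%g.
Proof. exact: (trace_ofM [:: a]). Qed.

Definition trace_head a x : bool := head_word a (repr x).

Definition trace_rem a x : trace I := trace_of I (rem a (repr x)).

Definition trace_length x : nat := size (repr x).

Lemma repr_trace_of w : trace_cong I (repr (trace_of I w)) w.
Proof. by apply/trace_ofP; rewrite trace_of_repr. Qed.

Lemma trace_headE a w : trace_head a (trace_of I w) = head_word a w.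
Proof.
apply: (trace_cong_invariant (f := head_word a)) (repr_trace_of w).
exact: head_word_swap.
Qed.

Lemma trace_remE a w : trace_rem a (trace_of I w) = trace_of I (rem a w).
Proof.
apply: (trace_cong_invariant (f := trace_of I \o rem a)) (repr_trace_of w).
by move=> *; exact: trace_of_rem_swap.
Qed.

Lemma trace_lengthE w : trace_length (trace_of I w) = size w.
Proof.
apply: (trace_cong_invariant (f := size)) (repr_trace_of w) => u v a b _.
by rewrite !size_cat.
Qed.

Lemma trace_ind (P : trace I -> Prop) :
  (forall w, P (trace_of I w)) -> forall x, P x.
Proof. by move=> Pw x; rewrite -[x]trace_of_repr. Qed.

Lemma trace_lengthM x y :
  trace_length (x * y)%g = (trace_length x + trace_length y)%N.
Proof.
elim/trace_ind: x => v; elim/trace_ind: y => w.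
by rewrite -trace_ofM !trace_lengthE size_cat.
Qed.

Lemma trace_length_letter a : trace_length (trace_of I [:: a]) = 1.
Proof. by rewrite trace_lengthE. Qed.

Lemma trace_length_eq0 x : trace_length x = 0 -> x = 1%g.
Proof.
by elim/trace_ind: x => w; rewrite trace_lengthE => /size0nil ->.
Qed.

Lemma trace_of_eq1 w : trace_of I w = 1%g -> w = [::].
Proof.
move=> w1; apply: size0nil; rewrite -trace_lengthE w1.
by rewrite -trace_of_nil trace_lengthE.
Qed.

Lemma trace_mul_eq1 x y : (x * y)%g = 1%g -> x = 1%g /\ y = 1%g.
Proof.
move=> /(congr1 trace_length); rewrite trace_lengthM -trace_of_nil.
rewrite trace_lengthE.
by move=> /eqP; rewrite addn_eq0 => /andP[/eqP xl /eqP yl]; split;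
   apply: trace_length_eq0.
Qed.

Lemma letter_comm a b : I a b ->
  (trace_of I [:: a] * trace_of I [:: b] =
   trace_of I [:: b] * trace_of I [:: a])%g.
Proof.
move=> Iab; rewrite -!trace_ofM.
by apply/trace_ofP/rst_step/(TraceSwap [::] [::]).
Qed.

Lemma letter_commute_word a w : all (I a) w ->
  (trace_of I [:: a] * trace_of I w = trace_of I w * trace_of I [:: a])%g.
Proof.
elim: w => [|b w IHw] /=; first by rewrite mulg1 mul1g.
move=> /andP[/letter_comm ab /IHw aw].
by rewrite (trace_of_cons b w) mulgA ab -!mulgA aw.
Qed.

(** If [a] does not occur in [w], then the [a] that moves to the front is one of
    [x], and it has to cross all of [w]. *)
Lemma trace_head_mul a w x : a \notin w ->
  trace_head a (trace_of I w * x)%g = all (I a) w && trace_head a x.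
Proof.
elim/trace_ind: x => v; rewrite -trace_ofM !trace_headE.
elim: w => //= b w IHw; rewrite inE => /norP[/negPf -> /IHw ->].
by rewrite andbA.
Qed.

Lemma trace_rem_mul a w x : a \notin w ->
  trace_rem a (trace_of I w * x)%g = (trace_of I w * trace_rem a x)%g.
Proof.
elim/trace_ind: x => v; rewrite -trace_ofM !trace_remE -trace_ofM => aw.
congr trace_of; elim: w aw => //= b w IHw.
by rewrite inE eq_sym => /norP[/negPf -> /IHw ->].
Qed.

Lemma trace_head_letter a x : trace_head a (trace_of I [:: a] * x)%g.
Proof.
by elim/trace_ind: x => v; rewrite -trace_ofM trace_headE /= eqxx.
Qed.

Lemma trace_rem_letter a x : trace_rem a (trace_of I [:: a] * x)%g = x.
Proof.
by elim/trace_ind: x => v; rewrite -trace_ofM trace_remE /= eqxx.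
Qed.

Lemma trace_head_rem a x :
  trace_head a x -> (trace_of I [:: a] * trace_rem a x)%g = x.
Proof.
elim/trace_ind: x => w; rewrite trace_headE trace_remE.
elim: w => //= b w IHw; have [->|ab] /= := eqVneq a b.
  by rewrite -trace_of_cons.
move=> /andP[Iab /IHw aw].
rewrite (trace_of_cons b w) (trace_of_cons b (rem a w)) mulgA letter_comm //.
by rewrite -mulgA aw.
Qed.

(** Multiplication by a letter on the left is undone by [trace_rem]. *)
Lemma trace_mulgI x : injective (fun y => x * y)%g.
Proof.
elim/trace_ind: x => w; elim: w => [|a w IHw] y z; first by rewrite !mul1g.
rewrite (trace_of_cons a w) -!mulgA => /(congr1 (trace_rem a)).
by rewrite !trace_rem_letter; exact: IHw.
Qed.

Lemma trace_head_exists x : x <> 1%g -> exists a, trace_head a x.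
Proof.
elim/trace_ind: x => -[//|a w] _; exists a.
by rewrite trace_headE /= eqxx.
Qed.

Section MinimalHead.

Variables (R : rel E) (R_wo : well_order R).

Definition is_min_head x a :=
  trace_head a x /\ forall b, trace_head b x -> R a b.

Definition min_head x : option E :=
  if pselect (exists a, is_min_head x a) is left ex
  then Some (projT1 (cid ex)) else None.

Variant min_head_spec x : option E -> Prop :=
| MinHeadOne : x = 1%g -> min_head_spec x None
| MinHeadSome a : x <> 1%g -> is_min_head x a -> min_head_spec x (Some a).

Lemma min_headP x : min_head_spec x (min_head x).
Proof.
rewrite /min_head; case: pselect => [ex|nex].
  constructor; last by case: cid.
  by case: ex => a [+ _] x1; rewrite x1 -trace_of_nil trace_headE.
constructor; apply: contra_notP nex => /trace_head_exists[a ax].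
have [|b [[bx b_min] _]] := R_wo (A := [pred b | trace_head b x]).
  by exists a.
by exists b; split=> // c; exact: b_min.
Qed.

End MinimalHead.

End TraceHeads.

(** * Alternating sums over the faces of a simplex *)

Section AlternatingSum.

Variables (E : eqType) (G : zmodType).

Implicit Types (k : E -> seq E -> G) (A B : seq E).

(** For A = (a_0, a_1, ...) this is the sum of the (-1)^i k a_i (A - a_i).  The
    head contributes the term of index 0; the other faces contain the head, and
    their signs are shifted by one. *)
Fixpoint altsum k A : G :=
  if A is a :: A' then k a A' - altsum (fun b B => k b (a :: B)) A' else 0.

Lemma altsum_ext k k' A :
    (forall u a v, A = u ++ a :: v -> k a (u ++ v) = k' a (u ++ v)) ->
  altsum k A = altsum k' A.
Proof.
elim: A k k' => //= a A IHA k k' kk'; congr (_ - _); first exact: (kk' [::]).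
by apply: IHA => u b v AE; apply: (kk' (a :: u)); rewrite AE.
Qed.

Lemma altsum0 A : altsum (fun _ _ => 0) A = 0.
Proof. by elim: A => //= a A ->; rewrite subrr. Qed.

Lemma altsumB k k' A :
  altsum (fun b B => k b B - k' b B) A = altsum k A - altsum k' A.
Proof.
elim: A k k' => [|a A IHA] k k' /=; first by rewrite subrr.
by rewrite IHA !opprD addrACA.
Qed.

(** Every pair of letters is removed in both orders, with opposite signs, and
    [k] is symmetric in the two letters.  This is why the boundary of a boundary
    vanishes. *)
Lemma altsum_altsum (r : rel E) (k : E -> E -> seq E -> G) A :
    (forall a b B, r a b -> k a b B = k b a B) -> pairwise r A ->
  altsum (fun a B => altsum (k a) B) A = 0.
Proof.
elim: A k => //= a A IHA k kC /andP[/allP ar rA].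
rewrite [altsum (fun _ _ => _ - _) A](altsumB (fun b B => k b a B)) IHA //.
  rewrite subr0; apply/eqP; rewrite subr_eq0; apply/eqP.
  apply: altsum_ext => u b v AE; apply/kC/ar.
  by rewrite AE mem_cat mem_head orbT.
by move=> b c B bc; exact: kC.
Qed.

End AlternatingSum.

Lemma raddf_altsum (E : eqType) (G H : zmodType) (f : {additive G -> H})
    (k : E -> seq E -> G) A :
  f (altsum k A) = altsum (fun a B => f (k a B)) A.
Proof.
by elim: A k => [|a A IHA] k /=; rewrite ?raddf0 // raddfB IHA.
Qed.

(** * The Koszul resolution *)

(** The category of elements of a right action of the trace monoid: a morphism
    out of [x] is given by its label, an arbitrary trace, and leads to the image
    of [x] under this trace. *)
Record action_category (E : choiceType) (I : rel E) := ActionCategory {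
  acat :> category;
  lact : acat -> trace I -> acat;
  label : forall x y : acat, Defs.hom x y -> trace I;
  label_id : forall x : acat, label (idm x) = 1%g;
  label_comp : forall (x y z : acat) (f : Defs.hom x y) (g : Defs.hom y z),
    label (Defs.comp f g) = (label f * label g)%g;
  label_target : forall (x y : acat) (f : Defs.hom x y), lact x (label f) = y;
  label_inj : forall (x y : acat) (f g : Defs.hom x y),
    label f = label g -> f = g;
  label_full : forall x mu, exists f : Defs.hom x (lact x mu), label f = mu }.

Section Action.

Variables (E : choiceType) (I : rel E) (C : action_category I).

Lemma lact1 (x : C) : lact x 1%g = x.
Proof. by rewrite -[in LHS](label_id x) label_target. Qed.

Lemma lactM (x : C) mu nu : lact x (mu * nu)%g = lact (lact x mu) nu.
Proof.
have [f fE] := label_full x mu; have [g gE] := label_full (lact x mu) nu.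
by rewrite -[in LHS]fE -[in LHS]gE -label_comp label_target.
Qed.

End Action.

Section IncreasingCliques.

Variables (E : choiceType) (I : rel E) (R : rel E).
Hypotheses (I_irr : irreflexive I) (I_sym : symmetric I).

(** Cliques are represented by increasing sequences: this gives the signs of
    their faces, and makes the least head of a trace the first letter of any
    clique of heads that contains it. *)
Definition increasing_adjacent : rel E := [rel a b | R a b && I a b].

Definition increasing_clique (n : nat) (A : seq E) : bool :=
  (size A == n) && pairwise increasing_adjacent A.

Lemma increasing_clique_cons n a A :
  increasing_clique n.+1 (a :: A) =
  all (increasing_adjacent a) A && increasing_clique n A.
Proof. by rewrite /increasing_clique /= eqSS andbCA. Qed.

Lemma face_adjacent n u a v :
  increasing_clique n (u ++ a :: v) -> all (I a) (u ++ v).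
Proof.
move=> /andP[_]; rewrite pairwise_cat pairwise_cons all_cat => /and3P[uav _].
move=> /andP[av _]; apply/andP; split; apply/allP => b b_in.
  move/allrelP: uav => /(_ b a b_in); rewrite mem_head I_sym.
  by move=> /(_ isT) /andP[].
by move/allP: av => /(_ b b_in) /andP[].
Qed.

Lemma face_notin n u a v : increasing_clique n (u ++ a :: v) -> a \notin u ++ v.
Proof.
move=> /face_adjacent /allP aI; apply/negP => /aI.
by rewrite I_irr.
Qed.

Lemma face_clique n u a v :
  increasing_clique n.+1 (u ++ a :: v) -> increasing_clique n (u ++ v).
Proof.
move=> /andP[/eqP sz uav]; apply/andP; split.
  by apply/eqP; move: sz; rewrite !size_cat /= addnS => -[].
apply: subseq_pairwise uav; apply: cat_subseq => //; exact: subseq_cons.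
Qed.

Lemma face_trace n u a v : increasing_clique n (u ++ a :: v) ->
  trace_of I (u ++ a :: v) = (trace_of I (u ++ v) * trace_of I [:: a])%g.
Proof.
move=> /face_adjacent; rewrite all_cat => /andP[au av].
rewrite !trace_ofM (trace_of_cons I a v) -!mulgA; congr (_ * _)%g.
exact: letter_commute_word.
Qed.

Lemma face_trace_l n u a v : increasing_clique n (u ++ a :: v) ->
  trace_of I (u ++ a :: v) = (trace_of I [:: a] * trace_of I (u ++ v))%g.
Proof.
move=> uav; rewrite (face_trace uav) letter_commute_word //.
exact: face_adjacent uav.
Qed.

Lemma face_total n u a v mu : increasing_clique n (u ++ a :: v) ->
  (trace_of I (u ++ v) * (trace_of I [:: a] * mu) =
   trace_of I (u ++ a :: v) * mu)%g.
Proof. by move=> /face_trace ->; rewrite mulgA. Qed.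

Lemma face_length n u a v mu : increasing_clique n (u ++ a :: v) ->
  (trace_length (trace_of I (u ++ v) * mu)%g <
   trace_length (trace_of I (u ++ a :: v) * mu)%g)%N.
Proof.
move=> /face_trace_l ->; rewrite -mulgA [X in (_ < X)%N]trace_lengthM.
by rewrite trace_length_letter.
Qed.

Lemma face_act (C : action_category I) (s : C) n u a v mu :
    increasing_clique n (u ++ a :: v) ->
  lact (lact s (trace_of I [:: a])) (trace_of I (u ++ v) * mu)%g =
  lact s (trace_of I (u ++ a :: v) * mu)%g.
Proof. by move=> /face_trace_l ->; rewrite -lactM mulgA. Qed.

Hypothesis R_wo : well_order R.

Lemma well_order_antisym : antisymmetric R.
Proof.
have /wo_chain_antisymmetric Ranti : @wo_chain E R predT by apply: withinW.
by move=> a b; exact: Ranti.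
Qed.

(** A letter of a clique commutes with all the others, so it comes first in a
    suitable order of the product. *)
Lemma clique_head n A mu : increasing_clique n A ->
  forall b, b \in A -> trace_head b (trace_of I A * mu)%g.
Proof.
move=> cA b bA; case/splitPr: bA cA => u v /face_trace_l ->.
by rewrite -mulgA trace_head_letter.
Qed.

(** [min_head_in] and [min_head_notin] say that the cliques dividing a given
    trace form a cone over its least head [a]: a clique either starts with [a]
    or can be extended by [a] in front.  In the first case the letters of the
    clique are heads, hence not smaller than [a]. *)
Lemma min_head_in n A mu a : increasing_clique n A ->
    is_min_head R (trace_of I A * mu)%g a -> a \in A ->
  exists A', A = a :: A'.
Proof.
case: A => // b A' cA [_ a_min].
rewrite inE => /orP[/eqP ->|aA']; exists A' => //.
congr (_ :: _); apply: well_order_antisym; apply/andP; split.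
  case: n cA => // n; rewrite increasing_clique_cons => /andP[/allP bA' _].
  by have /andP[] := bA' _ aA'.
by apply: a_min; apply: (clique_head _ cA); rewrite mem_head.
Qed.

(** Here [a] commutes with all of [A], so it is a head of [mu]; and it precedes
    the letters of [A], which are heads. *)
Lemma min_head_notin n A mu a : increasing_clique n A ->
    is_min_head R (trace_of I A * mu)%g a -> a \notin A ->
  increasing_clique n.+1 (a :: A) /\
  (trace_of I [:: a] * trace_rem a mu)%g = mu.
Proof.
move=> cA [a_head a_min] aA.
move: (a_head); rewrite trace_head_mul // => /andP[/allP aI a_mu].
split; last exact: trace_head_rem.
rewrite increasing_clique_cons cA andbT; apply/allP => b bA.
apply/andP; split; last exact: aI.
by apply: a_min; exact: (clique_head _ cA).
Qed.

End IncreasingCliques.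

Section Koszul.

Variables (E : choiceType) (I : rel E) (R : rel E).
Hypotheses (I_irr : irreflexive I) (I_sym : symmetric I) (R_wo : well_order R).
Variables (C : action_category I) (T : pred C).
Hypothesis T_closed : forall x mu, T (lact x mu) -> T x.

Local Notation tr := (trace_of I).
Local Notation iclique := (increasing_clique I R).

Definition cell (n : nat) := {p : C * seq E | T p.1 && iclique n p.2}.

Lemma cellP n (c : cell n) : T (val c).1 /\ iclique n (val c).2.
Proof. exact: andP (valP c). Qed.

Definition cell_target n (c : cell n) : C := lact (val c).1 (tr (val c).2).

(** At [t] this has a basis of triples (s, A, mu), consisting of a cell (s, A)
    and the label [mu] of a morphism from s . A to [t]. *)
Definition koszul (n : nat) : functor_ab C := free_functor (@cell_target n).

(** The basis element of a triple, and 0 if the triple does not index any: with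
    this convention the differential needs no case distinction for letters that
    lead out of [T]. *)
Definition kgen n t s A mu : koszul n t :=
  if pselect (exists p : free_index (@cell_target n) t,
    val (projT1 p) = (s, A) /\ label (projT2 p) = mu) is left ex
  then free_gen (projT1 (cid ex)) else 0.

Lemma kgenE n t (c : cell n) (f : Defs.hom (cell_target c) t) :
  kgen n t (val c).1 (val c).2 (label f) = fgen f.
Proof.
rewrite /kgen; case: pselect => [ex|[]]; last first.
  by exists (free_index_pair f); split=> //=; case: (val c).
case: cid => -[c' f'] /= [c'c f'f]; congr free_gen.
have {}c'c : c' = c by exact/val_inj/(etrans c'c)/esym/surjective_pairing.
by case: _ / c'c {ex} f f'f => f /label_inj ->.
Qed.

Lemma kgenP n t s A mu : T s -> iclique n A -> lact s (tr A * mu)%g = t ->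
  exists c : cell n, exists f : Defs.hom (cell_target c) t,
    [/\ val c = (s, A), label f = mu & kgen n t s A mu = fgen f].
Proof.
move=> Ts cA; rewrite lactM => st.
have cP : T (s, A).1 && iclique n (s, A).2 by rewrite Ts.
pose c : cell n := exist (fun p => T p.1 && iclique n p.2) (s, A) cP.
have [f fE] := label_full (cell_target c) mu.
subst t; exists c, f; split=> //.
by rewrite -kgenE fE.
Qed.

Lemma kgen0 n t s A mu : ~~ T s -> kgen n t s A mu = 0.
Proof.
move=> nTs; rewrite /kgen; case: pselect => // ex; exfalso.
case: ex => -[c f] /= [cE _].
case/negP: nTs; have [+ _] := cellP c.
by rewrite [X in T X.1]cE.
Qed.

(** An equation for triples whose [s] may lie outside of [T] follows from the
    equation for basis elements if both sides vanish outside of [T]. *)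
Lemma kgen_bind n t (G : zmodType) (g : {additive koszul n t -> G})
    (k : C -> seq E -> trace I -> G) :
    (forall (c : cell n) (f : Defs.hom (cell_target c) t),
      g (fgen f) = k (val c).1 (val c).2 (label f)) ->
    (forall s A mu, ~~ T s -> k s A mu = 0) ->
  forall s A mu, iclique n A -> lact s (tr A * mu)%g = t ->
  g (kgen n t s A mu) = k s A mu.
Proof.
move=> gE k0 s A mu cA st; have [Ts|nTs] := boolP (T s).
  by have [c [f [cE fE ->]]] := kgenP Ts cA st; rewrite gE cE fE.
by rewrite kgen0 // raddf0 k0.
Qed.

Lemma kgen_push n t t' (e : Defs.hom t t') s A mu :
    iclique n A -> lact s (tr A * mu)%g = t ->
  fmap (koszul n) e (kgen n t s A mu) = kgen n t' s A (mu * label e)%g.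
Proof.
apply: (kgen_bind (g := fmap (koszul n) e)
  (k := fun s A mu => kgen n t' s A (mu * label e)%g)) =>
  [c f|{}s {}A {}mu nTs].
  by apply: etrans (fgen_push _ _) _; rewrite -kgenE label_comp.
exact: kgen0.
Qed.

Definition koszul_d n : nat_trans (koszul n.+1) (koszul n) :=
  yoneda (G := koszul n) (fun c : cell n.+1 =>
    altsum (fun a B =>
        kgen n (cell_target c) (lact (val c).1 (tr [:: a])) B 1%g -
        kgen n (cell_target c) (val c).1 B (tr [:: a]))
      (val c).2).

Lemma koszul_d_kgen n t s A mu : iclique n.+1 A -> lact s (tr A * mu)%g = t ->
  koszul_d n t (kgen n.+1 t s A mu) =
  altsum (fun a B => kgen n t (lact s (tr [:: a])) B mu -
                     kgen n t s B (tr [:: a] * mu)%g) A.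
Proof.
apply: (kgen_bind (g := koszul_d n t) (k := fun s A mu =>
  altsum (fun a B => kgen n t (lact s (tr [:: a])) B mu -
                     kgen n t s B (tr [:: a] * mu)%g) A)) =>
  [c f|{}s {}A {}mu nTs].
  apply: etrans (yoneda_map_gen _ _) _.
  rewrite (raddf_altsum (fmap (koszul n) f)); apply: altsum_ext => u a v cE.
  have [_] := cellP c; rewrite [X in iclique _ X]cE => uav.
  have uv := face_clique uav.
  rewrite raddfB !kgen_push ?mul1g // /cell_target cE.
    by rewrite (face_trace I_sym uav).
  by rewrite mulg1 -lactM (face_trace_l I_sym uav).
rewrite -[RHS](altsum0 _ A); apply: altsum_ext => u a v _.
rewrite !kgen0 ?subrr //; apply: contra nTs; exact: T_closed.
Qed.

Lemma koszul_dd n t z : koszul_d n t (koszul_d n.+1 t z) = 0.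
Proof.
apply: (@free_functor_ext _ _ _ _ _ (koszul_d n t \o koszul_d n.+1 t) \0).
move=> c f.
rewrite -kgenE; set s := (val c).1; set A := (val c).2; set mu := label f.
have cA : iclique n.+2 A by have [] := cellP c.
have st : lact s (tr A * mu)%g = t by rewrite lactM label_target.
apply: etrans (congr1 (koszul_d n t) (koszul_d_kgen cA st)) _.
rewrite raddf_altsum.
(* The result of removing first [a] and then [b], which is symmetric in [a] and
   [b] if these letters commute. *)
pose K a b B :=
  (kgen n t (lact (lact s (tr [:: a])) (tr [:: b])) B mu -
   kgen n t (lact s (tr [:: a])) B (tr [:: b] * mu)%g) -
  (kgen n t (lact s (tr [:: b])) B (tr [:: a] * mu)%g -
   kgen n t s B (tr [:: b] * (tr [:: a] * mu))%g).
rewrite (altsum_ext (k' := fun a B => altsum (K a) B)) => [|u a v AE].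
  apply: (altsum_altsum (r := increasing_adjacent I R)) => [a b B|].
    move=> /andP[_ Iab]; rewrite /K.
    rewrite -!lactM !mulgA (letter_comm Iab).
    by rewrite !opprD addrACA.
  by have /andP[] := cA.
have uav : iclique n.+2 (u ++ a :: v) by rewrite -AE.
have uv := face_clique uav.
rewrite raddfB !koszul_d_kgen -?altsumB //; last first.
  by rewrite -lactM mulgA -(face_trace_l I_sym uav) -AE.
by rewrite mulgA -(face_trace I_sym uav) -AE.
Qed.

(** The cone over the least head of the product of [A] and [mu]; the product and
    [s] remain the same. *)
Definition cone_gen n t s A mu : koszul n t :=
  if min_head R (tr A * mu)%g is Some a then
    if a \in A then 0 else kgen n t s (a :: A) (trace_rem a mu)
  else 0.

Definition koszul_cone n t : {additive koszul n t -> koszul n.+1 t} :=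
  free_lift (fun p : free_index (@cell_target n) t =>
    cone_gen n.+1 t (val (projT1 p)).1 (val (projT1 p)).2 (label (projT2 p))).

Lemma cone_gen0 n t s A mu : ~~ T s -> cone_gen n t s A mu = 0.
Proof.
move=> nTs; rewrite /cone_gen; case: min_head => // a.
by case: ifP => // _; exact: kgen0.
Qed.

Lemma koszul_cone_kgen n t s A mu : iclique n A -> lact s (tr A * mu)%g = t ->
  koszul_cone n t (kgen n t s A mu) = cone_gen n.+1 t s A mu.
Proof.
apply: (kgen_bind (g := koszul_cone n t)) => [c f|{}s {}A {}mu].
  exact: free_lift_gen.
exact: cone_gen0.
Qed.

(** The subgroup spanned by the triples (s, A, mu) for which the product of [A]
    and [mu] is shorter than [k]. *)
Inductive low (k n : nat) (t : C) : koszul n t -> Prop :=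
| Low0 : low k 0
| LowB x y : low k x -> low k y -> low k (x - y)
| LowGen s A mu : iclique n A -> lact s (tr A * mu)%g = t ->
    (trace_length (tr A * mu)%g < k)%N -> low k (kgen n t s A mu).

Lemma lowD k n t (x y : koszul n t) : low k x -> low k y -> low k (x + y).
Proof.
move=> xl yl; rewrite -[y]opprK -[- y]add0r.
by do 2?apply: LowB => //; exact: Low0.
Qed.

Lemma low_altsum k n t (f : E -> seq E -> koszul n t) A :
    (forall u a v, A = u ++ a :: v -> low k (f a (u ++ v))) ->
  low k (altsum f A).
Proof.
elim: A f => [|a A IHA] f fl /=; first exact: Low0.
apply: LowB; first exact: (fl [::]).
by apply: IHA => u b v AE; apply: (fl (a :: u)); rewrite AE.
Qed.

Lemma low_cone k n t s A mu : iclique n A -> lact s (tr A * mu)%g = t ->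
  (trace_length (tr A * mu)%g < k)%N -> low k (cone_gen n.+1 t s A mu).
Proof.
move=> cA st lt; rewrite /cone_gen; case: min_headP => // [_|a _ a_min].
  exact: Low0.
case: ifPn => [_|aA]; first exact: Low0.
have [aAc muE] := min_head_notin I_irr I_sym cA a_min aA.
have aAE : (tr (a :: A) * trace_rem a mu = tr A * mu)%g.
  rewrite -[in RHS]muE mulgA; congr (_ * _)%g.
  exact: (face_trace I_sym (u := [::]) aAc).
by apply: LowGen; rewrite ?aAE.
Qed.

(** Up to shorter triples, coning contracts the part of the differential that
    keeps [s]; the sign is opposite to the usual one because this part is
    subtracted in the differential.  The alternating sum is the cone of the
    differential, written out so that [n] may be 0. *)
Lemma cone_homotopy n t s A mu :
    iclique n A -> lact s (tr A * mu)%g = t -> (tr A * mu)%g <> 1%g ->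
  low (trace_length (tr A * mu)%g)
    (koszul_d n t (cone_gen n.+1 t s A mu) +
     altsum (fun a B => cone_gen n t (lact s (tr [:: a])) B mu -
                        cone_gen n t s B (tr [:: a] * mu)%g) A +
     kgen n t s A mu).
Proof.
move=> cA st x1.
have [a aE a_min] : exists2 a, min_head R (tr A * mu)%g = Some a &
    is_min_head R (tr A * mu)%g a.
  by case: (min_headP I_sym R_wo (tr A * mu)%g) => // a _ a_min; exists a.
have [aA|aA] := boolP (a \in A).
  (* [A] is in the cone already: coning gives back [A] from the face opposite to
     [a], and 0 from the other faces. *)
  rewrite {1}/cone_gen aE aA raddf0 add0r.
  have [A' AE] := min_head_in I_sym R_wo cA a_min aA; subst A.
  case: n cA => [/andP[]//|n cA].
  have aA' := face_notin I_irr I_sym (u := [::]) cA.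
  have cA' := face_clique (u := [::]) cA.
  rewrite [altsum _ _]/=.
  rewrite [cone_gen n.+1 t s A' _]/cone_gen.
  rewrite (face_total I_sym (u := [::]) _ cA) aE.
  rewrite (negPf aA') (trace_rem_letter I_irr).
  rewrite addrAC subrK; apply: LowB.
    apply: low_cone => //.
      by rewrite -st; exact: (face_act I_sym (u := [::]) _ _ cA).
    exact: (face_length I_sym (u := [::]) _ cA).
  apply: low_altsum => u b v A'E.
  have cuv : iclique n.+1 ((a :: u) ++ b :: v) by rewrite /= -A'E.
  apply: LowB; last first.
    rewrite /cone_gen (face_total I_sym (u := a :: u) _ cuv) /= -A'E aE.
    by rewrite mem_head; exact: Low0.
  apply: low_cone; first exact: (face_clique (u := a :: u) cuv).
    by rewrite -st A'E; exact: (face_act I_sym (u := a :: u) _ _ cuv).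
  by rewrite A'E; exact: (face_length I_sym (u := a :: u) _ cuv).
have [caA muE] := min_head_notin I_irr I_sym cA a_min aA.
(* The face of [a :: A] opposite to [a] is [A]; the other faces are cones over
   the faces of [A]. *)
set mu' := trace_rem a mu in muE.
have totE : (tr (a :: A) * mu' = tr A * mu)%g.
  by rewrite -(face_total I_sym (u := [::]) _ caA) muE.
rewrite {1}/cone_gen aE (negPf aA) koszul_d_kgen ?totE //=.
rewrite -/mu' muE.
rewrite (altsum_ext (k := fun b B => cone_gen n t _ _ _ - _)
  (k' := fun b B => cone_gen n t (lact s (tr [:: b])) B mu -
                    kgen n t s (a :: B) (tr [:: b] * mu')%g)); last first.
  move=> u b v AE; congr (_ - _).
  have cuv : iclique n (u ++ b :: v) by rewrite -AE.
  rewrite /cone_gen (face_total I_sym _ cuv) -AE aE ifN; last first.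
    by apply: contra aA; rewrite AE !mem_cat inE orbCA => ->; rewrite orbT.
  rewrite (trace_rem_mul I_irr) // inE; apply: contra aA => /eqP->.
  by rewrite AE mem_cat mem_head orbT.
rewrite !altsumB addrAC (addrAC _ _ (kgen n t s A mu)) subrK.
set X := kgen _ _ _ _ _; set Y := altsum _ A; set Z := altsum _ A.
set W := altsum _ A.
have -> : X - (Y - Z) + (W - Z) = X - Y + W.
  by rewrite opprB [Z - Y]addrC (addrA X) [W - Z]addrC addrA addrK.
apply: lowD; first apply: LowB.
- apply: LowGen => //.
    by rewrite -st -totE; exact: (face_act I_sym (u := [::]) _ _ caA).
  by rewrite -totE; exact: (face_length I_sym (u := [::]) _ caA).
- apply: low_altsum => u b v AE.
  have cuv : iclique n.+1 ((a :: u) ++ b :: v) by rewrite /= -AE.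
  rewrite -totE; apply: LowGen; first exact: (face_clique cuv).
    by rewrite -st -totE AE; exact: (face_act I_sym _ _ cuv).
  by rewrite AE; exact: (face_length I_sym _ cuv).
apply: low_altsum => u b v AE.
have cuv : iclique n (u ++ b :: v) by rewrite -AE.
case: n cA st cuv X Y Z W caA => [|n] cA st cuv _ _ _ _ _.
  by case/andP: cA; rewrite AE size_cat /= addnS.
apply: low_cone; first exact: (face_clique cuv).
  by rewrite -st AE; exact: (face_act I_sym _ _ cuv).
by rewrite AE; exact: (face_length I_sym _ cuv).
Qed.


Lemma lowW k k' n t (x : koszul n t) : (k <= k')%N -> low k x -> low k' x.
Proof.
move=> kk'; elim=> [||s A mu cA st lt]; [exact: Low0|by move=> *; exact: LowB|].
by apply: LowGen => //; exact: leq_trans kk'.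
Qed.

Lemma low_exists n t (z : koszul n t) : exists k, low k z.
Proof.
elim/free_ab_ind: z => [|x y [k kx] [l ly]|[c f]].
- by exists 0; exact: Low0.
- exists (maxn k l); apply: LowB; [apply: lowW kx|apply: lowW ly].
    exact: leq_maxl.
  exact: leq_maxr.
exists (trace_length (tr (val c).2 * label f)%g).+1.
rewrite -[free_gen _]/(fgen f) -kgenE; apply: LowGen => //.
  by have [] := cellP c.
by rewrite lactM label_target.
Qed.

Lemma low0 n t (z : koszul n t) : low 0 z -> z = 0.
Proof.
by elim=> // x y _ -> _ ->; rewrite subrr.
Qed.

(** In positive degree every basis element has a nontrivial product of [A] and
    [mu], so [cone_homotopy] applies to all of them. *)
Lemma cone_homotopyS k n t (z : koszul n.+1 t) : low k.+1 z ->
  low k (koszul_d n.+1 t (koszul_cone n.+1 t z) +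
         koszul_cone n t (koszul_d n t z) + z).
Proof.
elim=> [|x y _ lx _ ly|s A mu cA st lt].
- by rewrite !raddf0 !addr0; exact: Low0.
- have := LowB lx ly; rewrite !raddfB !opprD.
  by rewrite [X in low k X -> _]addrACA [X in low k (X + _) -> _]addrACA.
rewrite koszul_cone_kgen // koszul_d_kgen // raddf_altsum.
have [x1|x1] := pselect ((tr A * mu)%g = 1%g).
  have [A1 _] := trace_mul_eq1 x1; have A0 := trace_of_eq1 A1.
  by move: cA; rewrite A0.
rewrite (altsum_ext (k' := fun a B =>
    cone_gen n.+1 t (lact s (tr [:: a])) B mu -
    cone_gen n.+1 t s B (tr [:: a] * mu)%g)) => [|u a v AE].
  apply: (lowW (k := trace_length (tr A * mu)%g)) => //.
  exact: cone_homotopy.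
have cuv : iclique n.+1 (u ++ a :: v) by rewrite -AE.
rewrite raddfB !koszul_cone_kgen //; try exact: (face_clique cuv).
  by rewrite (face_total I_sym _ cuv) -AE.
by rewrite (face_act I_sym _ _ cuv) -AE.
Qed.

(** A cycle is homologous to shorter and shorter cycles. *)
Lemma koszul_exactS n t (z : koszul n.+1 t) :
  koszul_d n t z = 0 <-> exists y, koszul_d n.+1 t y = z.
Proof.
split=> [|[y <-]]; last exact: koszul_dd.
have [k] := low_exists z; elim: k z => [|k IHk] z lz dz.
  by exists 0; rewrite raddf0 (low0 lz).
have := cone_homotopyS lz; rewrite dz raddf0 addr0 => /IHk[|y yE].
  by rewrite raddfD koszul_dd dz addr0.
by exists (y - koszul_cone n.+1 t z); rewrite raddfB yE addrAC subrr add0r.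
Qed.

(** In degree 0 the descent to shorter triples stops at the only triple over [t]
    whose product of [A] and [mu] is trivial. *)
Lemma koszul0_point t (z : koszul 0 t) :
  exists y m, z = koszul_d 0 t y + kgen 0 t t [::] 1%g *~ m.
Proof.
have [k] := low_exists z; elim: k z => [|k IHk] z.
  by move=> /low0 ->; exists 0, 0; rewrite raddf0 addr0.
elim=> [|_ _ _ [y [m ->]] _ [y' [m' ->]]|s A mu cA st lt].
- by exists 0, 0; rewrite raddf0 addr0.
- by exists (y - y'), (m - m'); rewrite raddfB mulrzBr opprD addrACA.
have A0 : A = [::] by apply: size0nil; have /andP[/eqP] := cA.
subst A; have [x1|x1] := pselect ((tr [::] * mu)%g = 1%g).
  exists 0, 1; rewrite raddf0 add0r mulr1z.
  by rewrite -st x1 lact1 -[in RHS]x1 mul1g.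
have := cone_homotopy cA st x1; rewrite [altsum _ _]/= addr0.
move=> /(lowW (k' := k) lt) /IHk[y [m yE]].
exists (y - cone_gen 1 t s [::] mu), m.
by rewrite raddfB addrAC -yE addrAC subrr add0r.
Qed.

(** [F] is, up to isomorphism, the functor with value Z on [T] and 0 elsewhere,
    and [pt x] is the generator of its value at [x]. *)
Section Augmentation.

Variables (F : functor_ab C) (pt : forall x, F x).
Hypotheses (pt_map : forall x y (f : Defs.hom x y), fmap F f (pt x) = pt y)
  (pt_gen : forall x (a : F x), exists m, a = pt x *~ m)
  (pt_free : forall x m, T x -> pt x *~ m = 0 -> m = 0)
  (pt0 : forall x, ~~ T x -> pt x = 0).

Definition koszul_aug : nat_trans (koszul 0) F :=
  yoneda (fun c : cell 0 => pt (cell_target c)).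

Lemma koszul_aug_kgen t s mu : lact s mu = t ->
  koszul_aug t (kgen 0 t s [::] mu) = pt t.
Proof.
move=> st; have [Ts|nTs] := boolP (T s); last first.
  rewrite kgen0 // raddf0 pt0 //; apply: contra nTs.
  by rewrite -st; exact: T_closed.
have [|c [f [_ _ ->]]] := @kgenP 0 t s [::] mu Ts isT; first by rewrite mul1g.
by apply: etrans (yoneda_map_gen _ _) _; exact: pt_map.
Qed.

Lemma koszul_aug_epi : nt_epi koszul_aug.
Proof.
move=> t b; have [m ->] := pt_gen b; exists (kgen 0 t t [::] 1%g *~ m).
by rewrite raddfMz koszul_aug_kgen // lact1.
Qed.

Lemma koszul_aug_d t y : koszul_aug t (koszul_d 0 t y) = 0.
Proof.
apply: (@free_functor_ext _ _ _ _ _ (koszul_aug t \o koszul_d 0 t) \0) => c f.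
rewrite -kgenE.
have [_ cA] := cellP c.
have st : lact (val c).1 (tr (val c).2 * label f)%g = t.
  by rewrite lactM label_target.
move: (val c).1 (val c).2 (label f) cA st => s [|a [|b A]] mu // cA st.
apply: etrans (congr1 (koszul_aug t) (koszul_d_kgen cA st)) _.
rewrite /= subr0 raddfB !koszul_aug_kgen ?subrr //.
by rewrite -lactM.
Qed.

Fact koszul_exact0 t z :
  koszul_aug t z = 0 <-> exists y, koszul_d 0 t y = z.
Proof.
split=> [|[y <-]]; last exact: koszul_aug_d.
have [y [m ->]] := koszul0_point z.
rewrite raddfD koszul_aug_d add0r raddfMz koszul_aug_kgen ?lact1 // => ptm.
exists y; have [Tt|nTt] := boolP (T t).
  by rewrite (pt_free Tt ptm) mulr0z addr0.
by rewrite kgen0 // mul0rz addr0.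
Qed.

Definition koszul_resolution : proj_resolution F :=
  @ProjResolution C F koszul
    (fun n => @free_functor_projective C _ (@cell_target n))
    koszul_d koszul_aug koszul_aug_epi koszul_exact0 koszul_exactS.

End Augmentation.

(** The cell as a basis element of the colimit, and 0 outside of [T], like
    [kgen]. *)
Definition cgen n s A : free_ab (cell n) :=
  if insub (s, A) is Some c then free_gen c else 0.

Definition cell_d n : {additive free_ab (cell n.+1) -> free_ab (cell n)} :=
  free_lift (fun c : cell n.+1 =>
    altsum (fun a B =>
        cgen n (lact (val c).1 (tr [:: a])) B - cgen n (val c).1 B)
      (val c).2).

Lemma cgenE n (c : cell n) : cgen n (val c).1 (val c).2 = free_gen c.
Proof. by rewrite /cgen -surjective_pairing valK. Qed.

Lemma cgen0 n s A : ~~ T s -> cgen n s A = 0.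
Proof. by move=> nTs; rewrite /cgen insubN //= negb_and nTs. Qed.

Lemma cgen_bind n (G : zmodType) (g : {additive free_ab (cell n) -> G})
    (k : C -> seq E -> G) :
    (forall c : cell n, g (free_gen c) = k (val c).1 (val c).2) ->
    (forall s A, ~~ T s -> k s A = 0) ->
  forall s A, iclique n A -> g (cgen n s A) = k s A.
Proof.
move=> gE k0 s A cA; have [Ts|nTs] := boolP (T s); last first.
  by rewrite cgen0 // raddf0 k0.
rewrite /cgen; case: insubP => [c _ cE|]; last by rewrite /= Ts cA.
by rewrite gE cE.
Qed.

Lemma cell_d_cgen n s A : iclique n.+1 A ->
  cell_d n (cgen n.+1 s A) =
  altsum (fun a B => cgen n (lact s (tr [:: a])) B - cgen n s B) A.
Proof.
apply: (cgen_bind (g := cell_d n) (k := fun s A =>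
  altsum (fun a B => cgen n (lact s (tr [:: a])) B - cgen n s B) A)) =>
  [c|{}s {}A nTs]; first exact: free_lift_gen.
rewrite -[RHS](altsum0 _ A); apply: altsum_ext => u a v _.
rewrite !cgen0 ?subrr //; apply: contra nTs; exact: T_closed.
Qed.

Lemma colim_free_kgen n t s A mu : iclique n A -> lact s (tr A * mu)%g = t ->
  colim_free (@cell_target n) (colim_in (kgen n t s A mu)) = cgen n s A.
Proof.
apply: (kgen_bind (g := colim_free (@cell_target n) \o @colim_in _ (koszul n) t)
  (k := fun s A _ => cgen n s A)) => [c f|{}s {}A _ nTs].
  by apply: etrans (colim_free_in _) _; rewrite cgenE.
exact: cgen0.
Qed.

Lemma colim_free_d n z :
  colim_free (@cell_target n) (colim_map (koszul_d n) z) =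
  cell_d n (colim_free (@cell_target n.+1) z).
Proof.
apply: (@colim_ext _ _ _ (colim_free (@cell_target n) \o colim_map (koszul_d n))
  (cell_d n \o colim_free (@cell_target n.+1))) => t.
apply: (@free_functor_ext _ _ _ _ _
  ((colim_free (@cell_target n) \o colim_map (koszul_d n)) \o
     @colim_in _ (koszul n.+1) t)
  ((cell_d n \o colim_free (@cell_target n.+1)) \o
     @colim_in _ (koszul n.+1) t)) => c f.
apply: etrans (congr1 _ (colim_map_in _ _)) _.
apply: etrans (esym (congr1 (cell_d n) (colim_free_in f))).
apply: etrans (esym (free_lift_gen _ _)).
have [_ cA] := cellP c.
have st : lact (val c).1 (tr (val c).2 * label f)%g = t.
  by rewrite lactM label_target.
rewrite -kgenE.
apply: etrans (congr1 (colim_free (@cell_target n) \o @colim_in _ (koszul n) t)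
  (koszul_d_kgen cA st)) _.
rewrite (raddf_altsum
  (colim_free (@cell_target n) \o @colim_in _ (koszul n) t)).
apply: altsum_ext => u a v AE; rewrite raddfB.
have cuv : iclique n.+1 (u ++ a :: v) by rewrite -AE.
congr (_ - _); apply: colim_free_kgen; try exact: (face_clique cuv).
  by rewrite (face_act I_sym _ _ cuv) -AE.
by rewrite (face_total I_sym _ cuv) -AE.
Qed.

(** The small complex is the colimit of the Koszul resolution of [F]. *)
Theorem action_category_homology (F : functor_ab C) (pt : forall x, F x) :
    (forall x y (f : Defs.hom x y), fmap F f (pt x) = pt y) ->
    (forall x (a : F x), exists m, a = pt x *~ m) ->
    (forall x m, T x -> pt x *~ m = 0 -> m = 0) ->
    (forall x, ~~ T x -> pt x = 0) ->
  forall n, zmod_isomorphic (cat_homology F n) (chain_homology cell_d n).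
Proof.
move=> pt_map pt_gen pt_free pt0 n.
apply: zmod_isomorphic_trans (resolution_independence _
  (koszul_resolution pt_map pt_gen pt_free pt0) n) _.
exact: (chain_homology_iso_of_iso
  (fun m => @colim_freeK _ _ (@cell_target m))
  (fun m => @free_colimK _ _ (@cell_target m)) colim_free_d).
Qed.

End Koszul.

(** * The categories of states and of prefixes *)

Section StateAction.

Variables (E : choiceType) (I : rel E) (L : set (trace I)).
Hypothesis L_prefix : prefix_closed L.

Fact state_label_full (s : state_category L_prefix) (mu : trace I) :
  exists f : Defs.hom s (act s mu : state_category L_prefix), sval f = mu.
Proof. by exists (exist (fun nu => act s nu = act s mu) mu erefl). Qed.

Definition state_action : action_category I :=
  @ActionCategory E I (state_category L_prefix) (@act E I L)
    (fun x y f => sval f) (fun x => erefl) (fun x y z f g => erefl)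
    (fun x y f => svalP f) (@act_hom_inj E I L) state_label_full.

End StateAction.

(** By left cancellation a prefix [v] of [w] determines the trace that leads
    from [v] to [w], so the order category is the category of elements of the
    action of the monoid on itself. *)
Section PrefixAction.

Variables (E : choiceType) (I : rel E).
Hypotheses (I_irr : irreflexive I) (I_sym : symmetric I).

Definition quotient (v w : prefix_category I) (vw : Defs.hom v w) : trace I :=
  projT1 (cid vw).

Lemma quotientP v w (vw : prefix_le v w) : (v * quotient vw)%g = w.
Proof. exact: projT2 (cid vw). Qed.

Fact quotient_id (v : prefix_category I) : quotient (idm v) = 1%g.
Proof. by apply: (trace_mulgI I_irr (x := v)); rewrite /= quotientP mulg1. Qed.

Fact quotient_comp (u v w : prefix_category I) (uv : Defs.hom u v)
    (vw : Defs.hom v w) :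
  quotient (Defs.comp uv vw) = (quotient uv * quotient vw)%g.
Proof.
by apply: (trace_mulgI I_irr (x := u)); rewrite /= mulgA !quotientP.
Qed.

Fact quotient_full (v : prefix_category I) (mu : trace I) :
  exists vw : Defs.hom v ((v * mu)%g : prefix_category I), quotient vw = mu.
Proof.
exists (ex_intro (fun nu => (v * nu)%g = (v * mu)%g) mu erefl).
by apply: (trace_mulgI I_irr (x := v)); rewrite /= quotientP.
Qed.

Fact quotient_inj (v w : prefix_category I) (f g : Defs.hom v w) :
  quotient f = quotient g -> f = g.
Proof. by move=> _; exact: (@Prop_irrelevance (prefix_le v w)). Qed.

Definition prefix_action : action_category I :=
  @ActionCategory E I (prefix_category I) (fun v mu => (v * mu)%g) quotient
    quotient_id quotient_comp quotientP quotient_inj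
    quotient_full.

End PrefixAction.

(** * Cliques as increasing sequences *)

Section CliqueSequences.

Variables (E : choiceType) (I : rel E) (R : rel E).
Hypotheses (I_irr : irreflexive I) (I_sym : symmetric I) (R_wo : well_order R).

Lemma well_order_total : total R.
Proof.
have /wo_chainW Rtot : @wo_chain E R predT by apply: withinW.
by move=> a b; exact: Rtot.
Qed.

Lemma well_order_trans : transitive R.
Proof.
move=> b a c ab bc; have Ranti := well_order_antisym R_wo.
have Rrefl d : R d d by rewrite -[R d d]orbb well_order_total.
have [|m [[mem_m m_min] _]] := R_wo (A := mem [:: a; b; c]).
  by exists a; rewrite !inE eqxx.
have mb : R m b by apply: m_min; rewrite !inE eqxx orbT.
have mc : R m c by apply: m_min; rewrite !inE eqxx !orbT.
have ma : R m a by apply: m_min; rewrite !inE eqxx.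
move: mem_m; rewrite !inE => /or3P[] /eqP mE; subst m => //.
  by rewrite (Ranti a b) ?ab.
by rewrite -(Ranti b c) ?bc.
Qed.

Lemma increasing_clique_uniq n A : increasing_clique I R n A -> uniq A.
Proof.
move=> /andP[_]; rewrite uniq_pairwise; apply: sub_pairwise => a b /andP[_].
by apply: contraTneq => ->; rewrite I_irr.
Qed.

(* Adjacency is made reflexive because it is for reflexive symmetric relations
   that [pairwise] does not depend on the order of the sequence. *)
Let adj_eq : rel E := [rel a b | (a == b) || I a b].

Let adj_eq_all2rel A : pairwise adj_eq A = all2rel adj_eq A.
Proof.
apply: pairwise_all2rel => [a|a b]; rewrite /adj_eq /= ?eqxx //.
by rewrite eq_sym I_sym.
Qed.

Lemma increasing_clique_fset n A :
  increasing_clique I R n A -> is_clique I n [fset a in A]%fset.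
Proof.
move=> cA; have A_uniq := increasing_clique_uniq cA.
case/andP: cA => /eqP An cA; apply/andP; split.
  by rewrite card_fseq undup_id // An.
have /allrelP A_adj : all2rel adj_eq A.
  rewrite -adj_eq_all2rel; apply: sub_pairwise cA => a b /andP[_ Iab].
  by rewrite /adj_eq /= Iab orbT.
apply/forallP => -[a aA]; apply/forallP => -[b bA]; apply/implyP => /= ab.
move: aA bA; rewrite !inE /= => aA bA.
by have /orP[/eqP abE|//] := A_adj _ _ aA bA; rewrite abE eqxx in ab.
Qed.

Lemma sort_clique n (B : {fset E}) :
  is_clique I n B -> increasing_clique I R n (sort R B).
Proof.
move=> /andP[/eqP Bn /forallP cB]; apply/andP; split.
  by rewrite size_sort Bn.
have B_adj : pairwise adj_eq (sort R B).
  rewrite adj_eq_all2rel; apply/allrelP => a b; rewrite !mem_sort => aB bB.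
  have /forallP /(_ [` bB]%fset) /implyP /= := cB [` aB]%fset.
  by rewrite /adj_eq /=; case: eqVneq => //= _; exact.
have B_uniq : uniq (sort R B) by rewrite sort_uniq fset_uniq.
have B_sorted : pairwise R (sort R B).
  rewrite -(sorted_pairwise well_order_trans).
  exact: sort_sorted well_order_total _.
rewrite pairwise_relI B_sorted /=.
have : pairwise [rel a b | (a != b) && adj_eq a b] (sort R B).
  by rewrite pairwise_relI -uniq_pairwise B_uniq B_adj.
by apply: sub_pairwise => a b /= /andP[/negPf ab]; rewrite /adj_eq /= ab.
Qed.

Lemma sort_fset n A :
  increasing_clique I R n A -> sort R [fset a in A]%fset = A.
Proof.
move=> cA; have A_uniq := increasing_clique_uniq cA.
apply: (sorted_eq well_order_trans (well_order_antisym R_wo)).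
- exact: sort_sorted well_order_total _.
- rewrite (sorted_pairwise well_order_trans).
  by case/andP: cA => _; apply: sub_pairwise => a b /andP[].
rewrite perm_sort; apply: uniq_perm => // a.
by rewrite inE.
Qed.

Lemma fset_sort (B : {fset E}) : [fset a in sort R B]%fset = B.
Proof. by apply/fsetP => a; rewrite inE mem_sort. Qed.

End CliqueSequences.

(** * Splitting off the base point *)

Section Splitting.

Variables (E : choiceType) (I : rel E) (R : rel E).
Hypotheses (I_irr : irreflexive I) (I_sym : symmetric I) (R_wo : well_order R).
Variables (L : set (trace I)) (L_prefix : prefix_closed L).

Let SA := state_action L_prefix.
Let PA := prefix_action I_irr.
Let ST : pred SA := predT.
Let LT : pred PA := fun v => v \in L.

Local Notation tr := (trace_of I).
Local Notation iclique := (increasing_clique I R).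
Local Notation scell := (cell R ST).
Local Notation lcell := (cell R LT).
Local Notation sgen := (@cgen E I R SA ST).
Local Notation lgen := (@cgen E I R PA LT).
Local Notation sd := (@cell_d E I R SA ST).
Local Notation ld := (@cell_d E I R PA LT).

Let ST_closed x mu : ST (@lact _ _ SA x mu) -> ST x. Proof. by []. Qed.

Let LT_closed x mu : LT (@lact _ _ PA x mu) -> LT x.
Proof. by move=> xmu; apply: (prefix_closed_le L_prefix xmu); exists mu. Qed.

Definition state_of (v : trace I) : pointed L := insub v.

(** Outside of [L] both sides are the base point, since the complement of [L] is
    stable under right multiplication. *)
Lemma act_state_of v a : act (state_of v) a = state_of (v * a)%g.
Proof.
rewrite /state_of; case: insubP => [u _ <-|nv] //=.
by rewrite insubN //; apply: contra nv; exact: LT_closed.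
Qed.

Definition qgen n (A : seq E) : free_ab (clique I n) :=
  if insub [fset a in A]%fset is Some q then free_gen q else 0.

Lemma qgen_sort n (q : clique I n) : qgen n (sort R (val q)) = free_gen q.
Proof. by rewrite /qgen fset_sort valK. Qed.

Lemma qgen_bind n (G : zmodType) (g : {additive free_ab (clique I n) -> G})
    (k : seq E -> G) :
    (forall q : clique I n, g (free_gen q) = k (sort R (val q))) ->
  forall A, iclique n A -> g (qgen n A) = k A.
Proof.
move=> gE A cA; rewrite /qgen; case: insubP => [q _ qE|].
  by rewrite gE qE (sort_fset I_irr R_wo cA).
by rewrite (increasing_clique_fset I_irr I_sym cA).
Qed.

(** [add_point] and [at_point] are the inclusions of the two summands of the
    complex of states, [forget_point] and [clique_part] the projections.  The
    cell over the base point is subtracted in [add_point] to make the image the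
    kernel of [clique_part]; in the complex of states a letter leading out of
    [L] gives this cell, in the complex of prefixes it gives 0. *)
Definition forget_point n : {additive free_ab (scell n) -> free_ab (lcell n)} :=
  free_lift (fun c : scell n =>
    if (val c).1 is Some v then lgen n (val v) (val c).2 else 0).

Definition add_point n : {additive free_ab (lcell n) -> free_ab (scell n)} :=
  free_lift (fun c : lcell n =>
    sgen n (state_of (val c).1) (val c).2 - sgen n None (val c).2).

Definition clique_part n :
    {additive free_ab (scell n) -> free_ab (clique I n)} :=
  free_lift (fun c : scell n => qgen n (val c).2).

Definition at_point n : {additive free_ab (clique I n) -> free_ab (scell n)} :=
  free_lift (fun q : clique I n => sgen n None (sort R (val q))).

Lemma forget_point_gen n s A : iclique n A ->
  forget_point n (sgen n s A) = if s is Some v then lgen n (val v) A else 0.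
Proof.
apply: (cgen_bind (g := forget_point n)
  (k := fun s A => if s is Some v then lgen n (val v) A else 0)) => //.
by move=> c; exact: free_lift_gen.
Qed.

Lemma forget_point_state n v A : iclique n A ->
  forget_point n (sgen n (state_of v) A) = lgen n v A.
Proof.
move=> cA; rewrite forget_point_gen // /state_of.
by case: insubP => [u _ -> //|vL]; rewrite cgen0.
Qed.

Lemma add_point_gen n v A : iclique n A ->
  add_point n (lgen n v A) = sgen n (state_of v) A - sgen n None A.
Proof.
apply: (cgen_bind (g := add_point n)
  (k := fun v A => sgen n (state_of v) A - sgen n None A)) => [c|{}v {}A vL].
  exact: free_lift_gen.
by rewrite /state_of insubN // subrr.
Qed.

Lemma clique_part_gen n s A : iclique n A ->
  clique_part n (sgen n s A) = qgen n A.
Proof.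
apply: (cgen_bind (g := clique_part n) (k := fun _ A => qgen n A)) => // c.
exact: free_lift_gen.
Qed.

Lemma at_point_gen n A : iclique n A -> at_point n (qgen n A) = sgen n None A.
Proof.
apply: (qgen_bind (g := at_point n)) => q; exact: free_lift_gen.
Qed.

Lemma state_complex_split n :
  zmod_isomorphic (chain_homology sd n)
    (chain_homology ld n * free_ab (clique I n))%type.
Proof.
have sort_q m (q : clique I m) : iclique m (sort R (val q)).
  by apply: sort_clique => //; exact: valP q.
have face m u a v A : iclique m.+1 A -> A = u ++ a :: v -> iclique m (u ++ v).
  by move=> cA AE; rewrite AE in cA; exact: face_clique cA.
apply: (chain_homology_split (p := forget_point) (i := add_point)
  (r := clique_part) (k := at_point)) => {n} n.
- apply: (@free_ext _ _ (forget_point n \o add_point n) idfun) => c.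
  have [_ cA] := cellP c; rewrite -cgenE.
  apply: etrans (congr1 (forget_point n) (add_point_gen _ cA)) _.
  by rewrite raddfB forget_point_state // forget_point_gen // subr0.
- apply: (@free_ext _ _ (clique_part n \o at_point n) idfun) => q.
  apply: etrans (congr1 (clique_part n) (free_lift_gen _ _)) _.
  by rewrite clique_part_gen ?qgen_sort.
- apply: (@free_ext _ _ (forget_point n \o at_point n) \0) => q.
  apply: etrans (congr1 (forget_point n) (free_lift_gen _ _)) _.
  by rewrite forget_point_gen.
- apply: (@free_ext _ _ (clique_part n \o add_point n) \0) => c.
  have [_ cA] := cellP c; rewrite -cgenE.
  apply: etrans (congr1 (clique_part n) (add_point_gen _ cA)) _.
  by rewrite raddfB !clique_part_gen // subrr.
- apply: (@free_ext _ _ ((add_point n \o forget_point n) \+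
    (at_point n \o clique_part n)) idfun) => c.
  have [_ cA] := cellP c; rewrite -cgenE.
  move: (val c).1 (val c).2 cA => s A cA.
  apply: etrans (congr2 _ (congr1 (add_point n) (forget_point_gen _ cA))
    (congr1 (at_point n) (clique_part_gen _ cA))) _.
  rewrite at_point_gen //; case: s => [v|]; last by rewrite raddf0 add0r.
  by rewrite add_point_gen // subrK /state_of valK.
- apply: (@free_ext _ _ (forget_point n \o sd n) (ld n \o forget_point n.+1)).
  move=> c.
  have [_ cA] := cellP c; rewrite -cgenE.
  move: (val c).1 (val c).2 cA => s A cA.
  apply: etrans (congr1 (forget_point n) (cell_d_cgen ST_closed _ cA)) _.
  apply: etrans (esym (congr1 (ld n) (forget_point_gen _ cA))).
  rewrite raddf_altsum; case: s => [v|]; last first.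
    rewrite raddf0 -[RHS](altsum0 _ A); apply: altsum_ext => u a w AE.
    by rewrite raddfB !forget_point_gen ?subrr //; exact: face AE.
  rewrite (cell_d_cgen LT_closed) //; apply: altsum_ext => u a w AE.
  rewrite raddfB -[X in lact X _](valK v) [lact _ _]act_state_of.
  rewrite forget_point_state ?forget_point_gen //; exact: face AE.
- apply: (@free_ext _ _ (add_point n \o ld n) (sd n \o add_point n.+1)) => c.
  have [_ cA] := cellP c; rewrite -cgenE.
  move: (val c).1 (val c).2 cA => v A cA.
  apply: etrans (congr1 (add_point n) (cell_d_cgen LT_closed _ cA)) _.
  apply: etrans (esym (congr1 (sd n) (add_point_gen _ cA))).
  rewrite raddf_altsum raddfB !(cell_d_cgen ST_closed) // -altsumB.
  apply: altsum_ext => u a w AE; have cuw := face _ _ _ _ _ cA AE.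
  rewrite raddfB !add_point_gen // [@lact _ _ SA (state_of v) _]act_state_of.
  by rewrite subrr subr0 opprB addrA subrK.
- apply: (@free_ext _ _ (clique_part n \o sd n) \0) => c.
  have [_ cA] := cellP c; rewrite -cgenE.
  apply: etrans (congr1 (clique_part n) (cell_d_cgen ST_closed _ cA)) _.
  rewrite raddf_altsum -[RHS](altsum0 _ (val c).2).
  apply: altsum_ext => u a w AE.
  by rewrite raddfB !clique_part_gen ?subrr //; exact: face AE.
- apply: (@free_ext _ _ (sd n \o at_point n.+1) \0) => q.
  apply: etrans (congr1 (sd n) (free_lift_gen _ _)) _.
  rewrite (cell_d_cgen ST_closed) // -[RHS](altsum0 _ (sort R (val q))).
  by apply: altsum_ext => u a w AE; rewrite subrr.
Qed.

End Splitting.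

Definition int_point (b : bool) : int_if b :=
  match b return int_if b with true => 1 :> int | false => tt end.

Theorem theorem3p7 (E : choiceType) (I : rel E)
    (I_irr : irreflexive I) (I_sym : symmetric I)
    (L : set (trace I)) (L_prefix : prefix_closed L) (n : nat) :
  zmod_isomorphic
    (cat_homology (const_functor (state_category L_prefix) int) n)
    (cat_homology (language_functor L_prefix) n * free_ab (clique I n))%type.
Proof.
have [R R_wo] := well_ordering_principle E.
have L_closed (v mu : trace I) : (v * mu)%g \in L -> v \in L.
  by move=> vmu; apply: (prefix_closed_le L_prefix vmu); exists mu.
have state_iso := @action_category_homology E I R I_irr I_sym R_wo
  (state_action L_prefix) predT (fun _ _ _ => isT)
  (const_functor (state_category L_prefix) int) (fun=> 1 : int).
have prefix_iso := @action_category_homology E I R I_irr I_sym R_wo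
  (prefix_action I_irr) (fun v => v \in L) L_closed
  (language_functor L_prefix) (fun v => int_point (v \in L)).
apply: zmod_isomorphic_trans (state_iso _ _ _ _ n) _ => //.
- by move=> s m; exists m; rewrite intz.
- by move=> s m _; rewrite intz.
apply: zmod_isomorphic_trans
  (state_complex_split I_irr I_sym R_wo L_prefix n) _.
apply/zmod_isomorphic_prod/zmod_isomorphic_sym/prefix_iso.
- move=> v w vw /=; have : w \in L -> v \in L.
    by move=> wL; exact: (prefix_closed_le L_prefix wL vw).
  by case: (v \in L) (w \in L) => [] [] //= /(_ isT).
- move=> v /=; case: (v \in L) => [m|[]] /=; last by exists 0.
  by exists m; rewrite intz.
- by move=> v m /= ->; rewrite /= intz.
- by move=> v /= /negPf ->.
Qed.
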